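(* Suppose $\eta\in[1,O(1)]$ and positive integers $(d_u,T_u)_{u=1}^m$ satisfy $d_u\le T_u$, $\sum_ud_u\le d$, and $\min_uT_u/d_u\ge\eta$. Fix $c\in\big[\max_u\frac{d_u}{T_u},\frac1{\eta^2}\min_u\frac{T_u}{d_u}\big]$. Then: (1) in every environment of the linear oblivious setting with domain structure $(d_u,T_u)_{u=1}^m$ (with $\|\theta^*\|_2\le C$, $|\langle\theta^*,x_t\rangle|\le1$), QuFUR$(c)$ has total cost $W=\tilde O\big(\sqrt c\sum_u\sqrt{T_ud_u}\big)$ with probability at least $1-\delta$; (2) for every algorithm there exists an environment with domain structure $(d_u,T_u)_{u=1}^m$, $\|\theta^*\|_2\le\sqrt d$ and $|\langle\theta^*,x_t\rangle|\le1$, under which its expected total cost is $\Omega\big(\sqrt c\sum_u\sqrt{T_ud_u}\big)$.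
   Context: Linear oblivious setting: $\theta^*\in\mathbb{R}^d$, $x_1,\dots,x_T$ ($\|x_t\|_2\le1$) fixed in advance; $y_t=\langle\theta^*,x_t\rangle+\xi_t$ with $\xi_t$ independent zero-mean sub-Gaussian with variance proxy $\eta^2$; $\tilde\eta=\max\{1,\eta\}$. Domain structure $(d_u,T_u)_{u=1}^m$: $[T]$ ($T=\sum_uT_u$) is partitioned into disjoint nonempty $I_1,\dots,I_m$ with $|I_u|=T_u$ and $\{x_t:t\in I_u\}$ in a subspace of dimension $d_u$. Regret $R=\sum_t(\hat y_t-\langle\theta^*,x_t\rangle)^2$, $Q=\sum_tq_t$, total cost $W=cR+Q$. QuFUR$(\alpha)$: $M\leftarrow C^{-2}I$, $\mathcal{Q}\leftarrow\emptyset$; at round $t$ with current $M_t$: $\hat\theta_t=M_t^{-1}\sum_{s\in\mathcal{Q}}x_sy_s$, predict $\hat y_t=\min(1,\max(-1,\langle\hat\theta_t,x_t\rangle))$, $\Delta_t=\tilde\eta^2\min\{1,x_t^\top M_t^{-1}x_t\}$, query independently with probability $\min\{1,\alpha\Delta_t\}$; if queried, $M\leftarrow M+x_tx_t^\top$, $\mathcal{Q}\leftarrow\mathcal{Q}\cup\{t\}$. $\tilde O$ hides absolute constants and factors polylogarithmic in $T,1/\delta,C$. *)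

(* Defs.v *)
From HB Require Import structures.
From mathcomp Require Import all_boot all_order all_algebra.
From mathcomp Require Import all_classical all_reals all_analysis.
Set Implicit Arguments. Unset Strict Implicit. Unset Printing Implicit Defensive.
Import Order.TTheory GRing.Theory Num.Theory.
Local Open Scope ring_scope.
Local Open Scope classical_set_scope.

Section Defs.
Variable R : realType.

Definition dotv (d : nat) (a b : 'rV[R]_d) : R := \sum_(i < d) a 0 i * b 0 i.
Definition norm2 (d : nat) (a : 'rV[R]_d) : R := Num.sqrt (dotv a a).

Definition clamp1 (z : R) : R := Num.min 1 (Num.max (-1) z).

(* A (possibly randomized) online algorithm.  At round t it receives
   - the contexts seen so far (x_s for s <= t; 0 beyond),
   - its past query decisions (q_s for s < t; false beyond),
   - the labels it has observed (y_s for s < t with q_s; 0 otherwise),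
   - its internal random seeds revealed so far (u_s for s <= t; 0 beyond),
   and outputs a prediction yhat_t and a query decision q_t. *)
Definition policy (d : nat) :=
  nat -> (nat -> 'rV[R]_d) -> (nat -> bool) -> (nat -> R) -> (nat -> R) -> R * bool.

Section Run.
Variables (d : nat) (alg : policy d) (x : nat -> 'rV[R]_d) (y u : nat -> R).

Definition step (t : nat) (q : nat -> bool) : R * bool :=
  alg t (fun s => if (s <= t)%N then x s else 0) q
        (fun s => if q s then y s else 0)
        (fun s => if (s <= t)%N then u s else 0).

Fixpoint qhist (t : nat) : nat -> bool :=
  match t with
  | 0 => fun _ => false
  | t'.+1 => let q := qhist t' in
             fun s => if s == t' then (step t' q).2 else q s
  end.

Definition pred_at (t : nat) : R := (step t (qhist t)).1.
Definition query_at (t : nat) : bool := (step t (qhist t)).2.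

Definition regret (th : 'rV[R]_d) (T : nat) : R :=
  \sum_(t < T) (pred_at t - dotv th (x t)) ^+ 2.
Definition nqueries (T : nat) : R := \sum_(t < T) (query_at t)%:R.
Definition total_cost (c : R) (th : 'rV[R]_d) (T : nat) : R :=
  c * regret th T + nqueries T.
End Run.

(* QuFUR(alpha) written as a policy; eta is the noise parameter
   (eta~ = max 1 eta) and C the norm bound used for M_0 = C^-2 I. *)
Definition qufur (d : nat) (alpha eta C : R) : policy d :=
  fun t xs qs ys us =>
    let M : 'M[R]_d := (C ^- 2)%:M + \sum_(s < t | qs s) ((xs s)^T *m xs s) in
    let b : 'rV[R]_d := \sum_(s < t | qs s) (ys s *: xs s) in
    let th := b *m invmx M in
    let Delta := (Num.max 1 eta) ^+ 2 * Num.min 1 (dotv (xs t *m invmx M) (xs t)) in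
    (clamp1 (dotv th (xs t)), us t < Num.min 1 (alpha * Delta)).

(* Domain structure (d_u, T_u)_{u<m} for the rounds 0..T-1, T = sum_u T_u:
   dom assigns each round to a domain; |I_u| = T_u and the contexts of
   I_u lie in the row space of a d_u x d matrix (a subspace of dim <= d_u). *)
Definition domain_structure (d m : nat) (dd TT : 'I_m -> nat)
    (x : nat -> 'rV[R]_d) (dom : nat -> 'I_m) : Prop :=
  (forall u : 'I_m, #|[set t : 'I_(\sum_(v < m) TT v) | dom t == u]| = TT u) /\
  exists B : forall u : 'I_m, 'M[R]_(dd u, d),
    forall t, (t < \sum_(v < m) TT v)%N -> (x t <= B (dom t))%MS.

Section Prob.
Context {dO : measure_display} {O : measurableType dO} (P : probability O R).

Definition mutually_independent (I : finType) (X : I -> O -> R) : Prop :=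
  (forall i, measurable_fun setT (X i)) /\
  forall (J : {set I}) (B : I -> set R), (forall i, measurable (B i)) ->
    P [set w | forall i, i \in J -> B i (X i w)] =
    (\prod_(i in J) P (X i @^-1` B i))%E.

Definition uniform01 (U : O -> R) : Prop :=
  measurable_fun setT U /\
  forall A : set R, measurable A ->
    P (U @^-1` A) = lebesgue_measure (A `&` `[0%R, 1%R]).

Definition subgaussian0 (xi : O -> R) (eta : R) : Prop :=
  measurable_fun setT xi /\ P.-integrable setT (EFin \o xi) /\
  ('E_P[xi] = 0)%E /\
  forall lam : R, ('E_P[fun w => expR (lam * xi w)] <= (expR (lam ^+ 2 * eta ^+ 2 / 2))%:E)%E.

Definition indep_pair (T : nat) (X Y : nat -> O -> R) : Prop :=
  mutually_independent (fun i : 'I_T + 'I_T =>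
    match i with inl t => X (nat_of_ord t) | inr t => Y (nat_of_ord t) end).
End Prob.
End Defs.

(* Main.v *)
Require Import Defs.
From HB Require Import structures.
From mathcomp Require Import all_boot all_order all_algebra.
From mathcomp Require Import all_classical all_reals all_analysis.
From mathcomp Require Import ring lra.
Set Implicit Arguments. Unset Strict Implicit. Unset Printing Implicit Defensive.
Import Order.TTheory GRing.Theory Num.Theory measurable_realfun.
Local Open Scope ring_scope.

(** Upper bound.  The queries of QuFUR depend on the contexts and on the coins [U] only, so
    the event that they follow a given 0/1 pattern is a product event in the coins.  Given
    the pattern the design is fixed and independent of the noise, and each prediction error
    is at most a logarithm times the capped width [w_t = min 1 (x_t M_t^-1 x_t^T)], without
    a dimension factor.  Within a domain the widths of the queried rounds sum to
    [d_u log T] (elliptic potential in orthonormal coordinates of the subspace), and an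
    exponential supermartingale transfers this to [sum p_t w_t] with [p_t = min 1 (c eta^2 w_t)];
    AM-GM then bounds [c sum w_t], hence the regret and the number of queries.

    Lower bound.  The contexts are basis vectors and [theta] has unknown signs with bias
    [eps]; the labels are two-valued.  The noise [g_t] rotates the unit interval by a hidden
    amount, so that for a fixed outcome of all seeds, averaging over the rotations
    already produces independent biased labels and the problem becomes finite.  For one coordinate with weights [a], [b] on its two signs, the
    cost to go over [r] rounds is at least [4 c r (eps l)^2 a b / (a + b)]: a round without query pays
    the decrement by the optimality of the posterior mean, and a query lowers the harmonic mean
    by a factor at least [1 - eps^2] only, which its unit price covers as soon as [c r eps^4 <= 1]. *)

(** * Ridge regression and the elliptic potential *)

Section LinearAlgebra.
Variable R : rcfType.

(** On the upper side a union bound over the [2^T] query patterns would ruin the logarithm. It costs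
    nothing here, because each tail bound is taken on the event of one pattern and keeps the
    probability of that pattern as a factor; these factors sum to at most 1, and only the union over
    rounds and domains is paid for. A confidence ellipsoid valid for designs that react to the noise
    would bring a dimension factor into each error.

    On the lower side the rotation amounts belong to the prior and not to the probability space. The
    algorithm is therefore deterministic while signs and rotations are averaged, and integration
    over the seeds happens only once, at the end. Finitely many cells force biases of the form
    [j / N]. The amplitude 1/4 of the labels makes the centred noise sub-Gaussian with variance
    proxy 1, hence with every [eta >= 1]. *)

Definition bilin n (M : 'M[R]_n) (y z : 'rV[R]_n) : R := (y *m M *m z^T) 0 0.
Definition qform n (M : 'M[R]_n) (z : 'rV[R]_n) : R := bilin M z z.
Definition posdef n (M : 'M[R]_n) : Prop :=
  M^T = M /\ forall z, z != 0 -> 0 < qform M z.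

Lemma qform1E n (z : 'rV[R]_n) : qform 1%:M z = \sum_i z 0 i ^+ 2.
Proof.
by rewrite /qform /bilin mulmx1 mxE; apply: eq_bigr => i _; rewrite mxE expr2.
Qed.

Lemma qform1_ge0 n (z : 'rV[R]_n) : 0 <= qform 1%:M z.
Proof. by rewrite qform1E sumr_ge0 // => i _; rewrite sqr_ge0. Qed.

Lemma qform1_gt0 n (z : 'rV[R]_n) : z != 0 -> 0 < qform 1%:M z.
Proof.
move=> z0; rewrite lt_neqAle qform1_ge0 andbT eq_sym qform1E.
apply: contra z0; rewrite psumr_eq0; last by move=> i _; rewrite sqr_ge0.
move/allP=> z0; apply/eqP/rowP => i; rewrite mxE.
by apply/eqP; rewrite -sqrf_eq0; apply: z0; rewrite mem_index_enum.
Qed.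

Lemma qform_posdef_ge0 n (M : 'M[R]_n) z : posdef M -> 0 <= qform M z.
Proof.
case=> _ pM; have [->|/pM/ltW//] := eqVneq z 0.
by rewrite /qform /bilin !mul0mx mxE.
Qed.

Lemma cauchy_schwarz_row n (y z : 'rV[R]_n) :
  bilin 1%:M y z ^+ 2 <= qform 1%:M y * qform 1%:M z.
Proof.
have [->|z0] := eqVneq z 0.
  by rewrite /qform /bilin trmx0 !mulmx0 mxE expr0n mulr0.
set p := bilin _ _ _; set q := qform _ y; set r := qform _ z.
have r0 : 0 < r by apply: qform1_gt0.
have := qform1_ge0 (r *: y - p *: z).
have -> : qform 1%:M (r *: y - p *: z) = r ^+ 2 * q - 2 * r * p * p + p ^+ 2 * r.
  have pE : p = \sum_i y 0 i * z 0 i.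
    by rewrite /p /bilin mulmx1 mxE; apply: eq_bigr => i _; rewrite mxE.
  rewrite qform1E /q {4}/r {3}pE !qform1E !mulr_sumr -sumrB -big_split /=.
  by apply: eq_bigr => i _; rewrite !mxE; ring.
rewrite (_ : _ + _ = r * (q * r - p ^+ 2)); last by ring.
by rewrite pmulr_rge0 // subr_ge0.
Qed.

Lemma posdef_unit n (M : 'M[R]_n) : posdef M -> M \in unitmx.
Proof.
case=> sM pM; rewrite -row_free_unit -kermx_eq0; apply/rowV0P => v /sub_kermxP vM.
apply/eqP; apply: contraT => /pM.
by rewrite /qform /bilin vM mul0mx mxE ltxx.
Qed.

Lemma invmx_sym n (M : 'M[R]_n) : M^T = M -> (invmx M)^T = invmx M.
Proof. by move=> sM; rewrite trmx_inv sM. Qed.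

Lemma qform_inv n (M : 'M[R]_n) x : posdef M ->
  qform (invmx M) x = qform M (x *m invmx M).
Proof.
move=> pM; have uM := posdef_unit pM; case: pM => sM _.
by rewrite /qform /bilin mulmxKV // trmx_mul invmx_sym // mulmxA.
Qed.

Lemma qform_inv_ge0 n (M : 'M[R]_n) x : posdef M -> 0 <= qform (invmx M) x.
Proof. by move=> pM; rewrite qform_inv // qform_posdef_ge0. Qed.

(* [x M^-1 x^T] is the maximum over [z] of [2 z x^T - z M z^T], so it decreases in [M]. *)
Lemma qform_inv_mono n (M A : 'M[R]_n) x : posdef M -> posdef A ->
  (forall z, qform A z <= qform M z) -> qform (invmx M) x <= qform (invmx A) x.
Proof.
move=> pM pA leAM.
have uM := posdef_unit pM; have uA := posdef_unit pA.
have [[sM _] [sA _]] := (pM, pA).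
set z := x *m invmx M.
have h1 : qform A z <= qform (invmx M) x by rewrite qform_inv //; apply: leAM.
have := qform_posdef_ge0 (z - x *m invmx A) pA.
have -> : qform A (z - x *m invmx A) = qform A z - 2 * qform (invmx M) x + qform (invmx A) x.
  rewrite {1}/qform /bilin mulmxBl linearB /= mulmxBr !mulmxBl.
  rewrite mulmxKV //.
  have -> : x *m z^T = z *m x^T by rewrite /z trmx_mul invmx_sym // mulmxA.
  have -> : z *m A *m (x *m invmx A)^T = z *m x^T.
    by rewrite trmx_mul invmx_sym // -mulmxA mulKVmx.
  rewrite (trmx_mul x (invmx A)) invmx_sym // mulmxA /qform /bilin -/z.
  move: (z *m A *m z^T) (z *m x^T) (x *m invmx A *m x^T) => P Q S.
  by rewrite !mxE; ring.
lra.
Qed.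

(** Eliminating the bordered matrix [B] through its corner 1 and through [A] computes [\det B] in
    two ways. *)
Lemma det_add_rank1 n (A : 'M[R]_n) (x : 'rV[R]_n) : A \in unitmx ->
  \det (A + x^T *m x) = \det A * (1 + qform (invmx A) x).
Proof.
move=> uA; pose B := block_mx (1%:M : 'M[R]_1) (- x) x^T A.
have e1 : block_mx (1%:M : 'M[R]_1) 0 (- x^T) 1%:M *m B = block_mx 1%:M (- x) 0 (A + x^T *m x).
  rewrite mulmx_block !mul1mx !mul0mx !addr0 mulmx1 addNr.
  by rewrite mulmxN mulNmx opprK addrC.
have e2 : block_mx (1%:M : 'M[R]_1) (x *m invmx A) 0 1%:M *m B
    = block_mx (1%:M + x *m invmx A *m x^T) 0 x^T A.
  by rewrite mulmx_block !mul1mx !mul0mx !add0r mulmxKV // addNr.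
have d1 := congr1 determinant e1; have d2 := congr1 determinant e2.
move: d1 d2; rewrite !det_mulmx !det_ublock !det_lblock !det1 !mul1r => <- ->.
by rewrite det_mx11 mulrC mxE [(1%:M : matrix _ _ _) _ _]mxE eqxx.
Qed.

(** Hadamard's inequality by induction on the Schur complement [S], which is again positive definite
    and whose diagonal is that of [D] minus nonnegative terms. *)
Lemma posdef_det n (M : 'M[R]_n) : posdef M -> 0 < \det M <= \prod_i M i i.
Proof.
elim: n M => [|n IH] M pM; first by rewrite det_mx00 big_ord0 ltr01 lexx.
rewrite -[n.+1]/(1 + n)%N in M pM *; rewrite -[M]submxK in pM *.
set a := ulsubmx _ in pM *; set v := ursubmx _ in pM *.
set v' := dlsubmx _ in pM *; set D := drsubmx _ in pM *.
have [sM qM] := pM.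
move: (sM); rewrite tr_block_mx => /eq_block_mx [_ sv' sv sD].
have a0 : 0 < a 0 0.
  have := qM (row_mx 1%:M 0).
  rewrite /qform /bilin mul_row_block tr_row_mx mul_row_col !mul1mx !mul0mx !addr0.
  rewrite trmx0 mulmx0 addr0 trmx1 mulmx1; apply.
  apply/eqP => /(congr1 (fun A : 'M[R]_(1, 1 + n) => lsubmx A 0 0)).
  by rewrite row_mxKl !mxE eqxx; apply/eqP; rewrite oner_eq0.
have ea : a = (a 0 0)%:M by rewrite [LHS]mx11_scalar.
set al := a 0 0 in a0 ea.
pose S := D - al^-1 *: (v^T *m v).
have e1 : block_mx (1%:M : 'M[R]_1) 0 (- al^-1 *: v^T) 1%:M *m block_mx a v v' D
    = block_mx a v 0 S.
  rewrite mulmx_block !mul1mx !mul0mx !addr0 ea -sv.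
  rewrite mul_mx_scalar scalerA mulrN divff ?gt_eqF // scaleN1r addNr.
  by rewrite -!scalemxAl scaleNr addrC.
have dM : \det (block_mx a v v' D) = al * \det S.
  by have := congr1 determinant e1; rewrite det_mulmx det_lblock det_ublock !det1 !mul1r det_mx11.
have pS : posdef S.
  split; first by rewrite /S linearB /= linearZ /= trmx_mul trmxK sD.
  move=> z z0.
  (* This first coordinate minimises the form for a given [z], and the minimum is [qform S z]. *)
  have := qM (row_mx (- al^-1 *: (z *m v^T)) z).
  have -> : qform (block_mx a v v' D) (row_mx (- al^-1 *: (z *m v^T)) z) = qform S z.
    rewrite /qform /bilin mul_row_block tr_row_mx mul_row_col.
    rewrite -sv -scalemxAl ea mul_mx_scalar scalerA mulNr mulVf ?gt_eqF // scaleN1r addNr mul0mx add0r.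
    by rewrite /S mulmxBr -scalemxAl -scalemxAr scaleNr mulmxA addrC.
  apply; apply: contra z0 => /eqP e.
  by rewrite -(row_mxKr (- al^-1 *: (z *m v^T)) z) e linear0.
have /andP[S0 Sle] := IH _ pS.
rewrite dM mulr_gt0 //=.
rewrite (@big_split_ord _ _ _ 1 n) big_ord1 /= block_mxEul -/al.
rewrite ler_wpM2l ?(ltW a0) //; apply: le_trans Sle _.
apply: ler_prod => i _; rewrite block_mxEdr.
apply/andP; split.
  have d0 : delta_mx 0 i != 0 :> 'rV[R]_n.
    by apply/eqP => /rowP /(_ i); rewrite !mxE !eqxx; apply/eqP; rewrite oner_eq0.
  by move: (pS.2 _ d0); rewrite /qform /bilin trmx_delta -rowE -colE mxE mxE => /ltW.
by rewrite !mxE gerBl mulr_ge0 ?invr_ge0 ?(ltW a0) // sumr_ge0 // => j _; rewrite mxE -expr2 sqr_ge0.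
Qed.

Definition gram n (lam : R) (x : nat -> 'rV[R]_n) (q : pred nat) t : 'M[R]_n :=
  lam%:M + \sum_(s < t | q s) (x s)^T *m x s.

Lemma qform_gram n lam (x : nat -> 'rV[R]_n) q t z :
  qform (gram lam x q t) z
  = lam * qform 1%:M z + \sum_(s < t | q s) bilin 1%:M (x s) z ^+ 2.
Proof.
rewrite /qform /bilin mulmxDr mulmxDl mxE mul_mx_scalar mulmx1 -scalemxAl mxE; congr (_ + _).
rewrite mulmx_sumr mulmx_suml summxE; apply: eq_bigr => s _.
rewrite mulmx1 mulmxA -mulmxA mxE big_ord1 expr2; congr (_ * _).
by rewrite -[in LHS](trmxK (z *m _)) mxE trmx_mul trmxK.
Qed.

Lemma gram_posdef n lam (x : nat -> 'rV[R]_n) q t : 0 < lam -> posdef (gram lam x q t).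
Proof.
move=> l0; split.
  rewrite /gram linearD /= tr_scalar_mx linear_sum /=; congr (_ + _).
  by apply: eq_bigr => s _; rewrite trmx_mul trmxK.
move=> z z0; rewrite qform_gram ltr_pwDl ?mulr_gt0 ?qform1_gt0 //.
by rewrite sumr_ge0 // => s _; rewrite sqr_ge0.
Qed.

Lemma gramS n lam (x : nat -> 'rV[R]_n) q t :
  gram lam x q t.+1 = gram lam x q t + (if q t then (x t)^T *m x t else 0).
Proof. by rewrite /gram big_mkcond big_ord_recr /= -big_mkcond /= addrA. Qed.

Lemma det_gram_prod n lam (x : nat -> 'rV[R]_n) q t : 0 < lam ->
  \det (gram lam x q t)
  = lam ^+ n * \prod_(s < t | q s) (1 + qform (invmx (gram lam x q s)) (x s)).
Proof.
move=> l0; elim: t => [|t IH].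
  by rewrite /gram !big_ord0 addr0 det_scalar mulr1.
rewrite gramS big_mkcond big_ord_recr -big_mkcond /=.
case: (q t); last by rewrite addr0 mulr1.
by rewrite det_add_rank1 ?(posdef_unit (gram_posdef _ _ _ l0)) // IH mulrA.
Qed.

Lemma qform1_coord n (z : 'rV[R]_n) i : z 0 i ^+ 2 <= qform 1%:M z.
Proof.
rewrite qform1E (bigD1 i) //= lerDl sumr_ge0 // => j _; exact: sqr_ge0.
Qed.

(** By [det_gram_prod] the product is the determinant divided by [lam ^+ n], and Hadamard's
    inequality bounds the determinant by diagonal entries that are at most [lam + t]. *)
Lemma elliptic_potential n lam (x : nat -> 'rV[R]_n) (q : pred nat) t : 0 < lam ->
  (forall s, (s < t)%N -> q s -> qform 1%:M (x s) <= 1) ->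
  \prod_(s < t | q s) (1 + qform (invmx (gram lam x q s)) (x s))
    <= (1 + t%:R / lam) ^+ n.
Proof.
move=> l0 x1.
have := posdef_det (gram_posdef x q t l0).
rewrite det_gram_prod // => /andP[_ le1].
rewrite -(ler_pM2l (exprn_gt0 n l0)) (le_trans le1) //.
rewrite -exprMn mulrDr mulr1 mulrC mulfVK ?gt_eqF //.
rewrite -[n in leRHS]card_ord -prodr_const.
apply: ler_prod => i _; rewrite mxE summxE mxE eqxx mulr1n.
have h s : q s -> ((x s)^T *m x s) i i = x s 0 i ^+ 2 by rewrite mxE big_ord1 mxE.
under eq_bigr => s qs do rewrite h //.
have -> : 0 <= lam + \sum_(s < t | q s) x s 0 i ^+ 2.
  by rewrite addr_ge0 ?(ltW l0) // sumr_ge0 // => s _; rewrite sqr_ge0.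
rewrite lerD2l.
have -> : t%:R = \sum_(s < t) (1 : R) by rewrite sumr_const card_ord.
rewrite big_mkcond; apply: ler_sum => s _; case: ifP => // qs.
exact: le_trans (qform1_coord _ _) (x1 _ (ltn_ord s) qs).
Qed.

(** Gram-Schmidt, one row at a time; [k'] can be smaller than [k] because a row already in the span
    adds no vector. *)
Lemma orthonormal_cover k n (B : 'M[R]_(k, n)) :
  exists k' (E : 'M[R]_(k', n)), [/\ (k' <= k)%N, E *m E^T = 1%:M & (B <= E)%MS].
Proof.
elim: k B => [|k IH] B.
  exists 0, 0; split => //; first by apply/matrixP => -[].
  by rewrite flatmx0 sub0mx.
rewrite -[k.+1]/(1 + k)%N in B *; rewrite -[B]vsubmxK; set b := usubmx _; set B' := dsubmx _.
have [k' [E [k'k oE sE]]] := IH B'.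
pose r := b - b *m E^T *m E.
have sbr : b = r + b *m E^T *m E by rewrite subrK.
have rE : r *m E^T = 0 by rewrite mulmxBl -!mulmxA oE mulmx1 subrr.
have [r0|rn0] := eqVneq r 0.
  exists k', E; split => //; first exact: leqW.
  by rewrite col_mx_sub sE andbT sbr r0 add0r submxMl.
have q0 : 0 < qform 1%:M r by apply: qform1_gt0.
pose e := (Num.sqrt (qform 1%:M r))^-1 *: r.
exists (1 + k')%N, (col_mx e E); split => //.
- rewrite tr_col_mx mul_col_row oE [RHS]scalar_mx_block.
  have eE : e *m E^T = 0 by rewrite -scalemxAl rE scaler0.
  rewrite eE; have -> : E *m e^T = 0.
    by rewrite -[LHS]trmxK trmx_mul trmxK eE trmx0.
  congr block_mx; rewrite [LHS]mx11_scalar; congr (_%:M).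
  rewrite /e linearZ /= -scalemxAl -scalemxAr scalerA mxE.
  have -> : (r *m r^T) 0 0 = qform 1%:M r by rewrite /qform /bilin mulmx1.
  by rewrite -expr2 exprVn sqr_sqrtr ?(ltW q0) // mulVf ?gt_eqF.
- rewrite col_mx_sub; apply/andP; split; last first.
    by apply: submx_trans sE _; apply/submxP; exists (row_mx 0 1%:M); rewrite mul_row_col mul0mx mul1mx add0r.
  rewrite sbr; apply: addmx_sub.
    apply/submxP; exists (row_mx (Num.sqrt (qform 1%:M r))%:M 0).
    rewrite mul_row_col mul0mx addr0 mul_scalar_mx scalerA divff ?scale1r //.
    by rewrite gt_eqF // sqrtr_gt0.
  by apply/submxP; exists (row_mx 0 (b *m E^T)); rewrite mul_row_col mul0mx add0r.
Qed.

(* In orthonormal coordinates of the subspace the Gram matrix of the contexts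
   has size [k] instead of [n]. *)
Lemma qform_inv_gram_coord n k (E : 'M[R]_(k, n)) lam (x : nat -> 'rV[R]_n) (q : pred nat) t (y : 'rV[R]_n) :
  0 < lam -> E *m E^T = 1%:M -> (forall s, (s < t)%N -> q s -> (x s <= E)%MS) -> (y <= E)%MS ->
  qform (invmx (gram lam x q t)) y
  = qform (invmx (gram lam (fun s => x s *m E^T) q t)) (y *m E^T).
Proof.
move=> l0 oE xE yE.
have inE (z : 'rV[R]_n) : (z <= E)%MS -> z *m E^T *m E = z.
  by case/submxP => D ->; rewrite -!mulmxA (mulmxA E) oE mul1mx.
set A := gram lam x q t; set V := gram _ _ _ _.
have uA : A \in unitmx by apply/posdef_unit/gram_posdef.
have uV : V \in unitmx by apply/posdef_unit/gram_posdef.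
have VE : V *m E = E *m A.
  rewrite mulmxDl mulmxDr scalar_mxC; congr (_ + _).
  rewrite mulmx_suml mulmx_sumr; apply: eq_bigr => s qs.
  rewrite -mulmxA inE; last exact: xE.
  by rewrite trmx_mul trmxK mulmxA.
have EA : E *m invmx A = invmx V *m E.
  by rewrite -[LHS](mulKmx uV) (mulmxA V) VE mulmxK.
rewrite /qform /bilin -{1}(inE y yE) -[_ *m E *m invmx A]mulmxA EA trmx_mul trmxK.
by rewrite !mulmxA.
Qed.

Lemma qform_inv_gram_sub n lam (x : nat -> 'rV[R]_n) (q q' : pred nat) t y :
  0 < lam -> (forall s, q' s -> q s) ->
  qform (invmx (gram lam x q t)) y <= qform (invmx (gram lam x q' t)) y.
Proof.
move=> l0 q'q; apply: qform_inv_mono; try exact: gram_posdef.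
move=> z; rewrite !qform_gram lerD2l big_mkcond [leRHS]big_mkcond /=.
apply: ler_sum => s _; case: ifP => [/q'q ->//|_]; case: ifP => // _; exact: sqr_ge0.
Qed.

(** The widths refer to all queried rounds [q], whereas the potential telescopes within the rounds
    [q'] of one domain. Dropping the other rounds only increases the widths, after which everything
    lives in the subspace. *)
Lemma elliptic_potential_subspace n k (B : 'M[R]_(k, n)) lam (x : nat -> 'rV[R]_n)
    (q q' : pred nat) t :
  0 < lam -> (forall s, q' s -> q s) ->
  (forall s, (s < t)%N -> q' s -> qform 1%:M (x s) <= 1 /\ (x s <= B)%MS) ->
  \prod_(s < t | q' s) (1 + qform (invmx (gram lam x q s)) (x s))
    <= (1 + t%:R / lam) ^+ k.
Proof.
move=> l0 q'q xB; have [k' [E [k'k oE sBE]]] := orthonormal_cover B.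
have t0 : 0 <= t%:R / lam by rewrite divr_ge0 ?ler0n ?(ltW l0).
apply: (@le_trans _ _ ((1 + t%:R / lam) ^+ k')); last first.
  by rewrite ler_weXn2l // lerDl.
have xE s : (s < t)%N -> q' s -> (x s <= E)%MS.
  by move=> st qs; apply: submx_trans sBE; case: (xB _ st qs).
apply: le_trans (elliptic_potential (x := fun s => x s *m E^T) (q := q') l0 _).
  apply: ler_prod => s qs; rewrite addr_ge0 ?qform_inv_ge0 ?lerD2l //=; last exact: gram_posdef.
  apply: le_trans (qform_inv_gram_sub x s _ l0 q'q) _.
  rewrite (qform_inv_gram_coord (E := E)) // ?xE // => r rs qr.
  by apply: xE => //; apply: ltn_trans rs _.
move=> s st qs; have [x1 _] := xB _ st qs.
have /submxP[D xD] := xE _ st qs.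
apply: le_trans x1; rewrite le_eqVlt; apply/orP; left; apply/eqP.
by rewrite /qform /bilin !mulmx1 xD !trmx_mul -!mulmxA (mulmxA E) oE mul1mx trmxK !mulmxA -(mulmxA D E) oE mulmx1.
Qed.

(** The noiseless part of the right-hand side is [th *m M - lam *: th], so the error is a term
    linear in [xi] and a bias due to the regulariser. *)
Lemma ridge_error n (lam : R) (x : nat -> 'rV[R]_n) (q : pred nat) t (th : 'rV[R]_n) (xi : nat -> R) y :
  0 < lam ->
  bilin 1%:M ((\sum_(s < t | q s) (bilin 1%:M th (x s) + xi s) *: x s)
               *m invmx (gram lam x q t)) y - bilin 1%:M th y
  = \sum_(s < t | q s) bilin (invmx (gram lam x q t)) (x s) y * xi s
    - lam * bilin 1%:M th (y *m invmx (gram lam x q t)).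
Proof.
move=> l0; set M := gram lam x q t.
have pM : posdef M by apply: gram_posdef.
have uM := posdef_unit pM.
have e1 : \sum_(s < t | q s) bilin 1%:M th (x s) *: x s = th *m M - lam *: th.
  rewrite /M mulmxDr mul_mx_scalar addrC addKr mulmx_sumr; apply: eq_bigr => s _.
  by rewrite mulmxA [th *m _]mx11_scalar mul_scalar_mx /bilin mulmx1.
under eq_bigr => s _ do rewrite scalerDl.
have e2 : ((\sum_(s < t | q s) xi s *: x s) *m invmx M *m y^T) 0 0
    = \sum_(s < t | q s) bilin (invmx M) (x s) y * xi s.
  rewrite !mulmx_suml summxE; apply: eq_bigr => s _.
  by rewrite -!scalemxAl mxE mulrC.
rewrite big_split /= e1 -e2 /bilin !mulmx1 mulmxDl mulmxBl mulmxK // -scalemxAl.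
rewrite trmx_mul invmx_sym ?mulmxA; last by case: pM.
rewrite !mulmxDl mulNmx -scalemxAl.
move: (_ *m invmx M *m y^T) (th *m invmx M *m y^T) (th *m y^T) => A B D.
by rewrite !mxE; ring.
Qed.

(** With [z = y M^-1] the weights are the inner products of [x s] and [z]; their squares sum to the
    form of [M - lam I] at [z], at most that of [M]. No dimension appears. *)
Lemma ridge_noise_weight n (lam : R) (x : nat -> 'rV[R]_n) (q : pred nat) t y : 0 < lam ->
  \sum_(s < t | q s) bilin (invmx (gram lam x q t)) (x s) y ^+ 2
    <= qform (invmx (gram lam x q t)) y.
Proof.
move=> l0; have pM := gram_posdef x q t l0.
rewrite qform_inv // qform_gram.
have e s : bilin (invmx (gram lam x q t)) (x s) y
    = bilin 1%:M (x s) (y *m invmx (gram lam x q t)).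
  by rewrite /bilin mulmx1 trmx_mul invmx_sym ?mulmxA //; case: pM.
under eq_bigr => s _ do rewrite e.
by rewrite lerDr mulr_ge0 ?(ltW l0) ?qform1_ge0.
Qed.

(** Cauchy-Schwarz; for [lam = C^-2] the hypothesis on [th] says that its norm is at most [C]. *)
Lemma ridge_bias n (lam : R) (x : nat -> 'rV[R]_n) (q : pred nat) t (th y : 'rV[R]_n) : 0 < lam ->
  lam * qform 1%:M th <= 1 ->
  (lam * bilin 1%:M th (y *m invmx (gram lam x q t))) ^+ 2
    <= qform (invmx (gram lam x q t)) y.
Proof.
move=> l0 th1; have pM := gram_posdef x q t l0.
rewrite qform_inv // qform_gram; set z := y *m _.
apply: (@le_trans _ _ (lam * qform 1%:M z)); last first.
  by rewrite lerDl sumr_ge0 // => s _; rewrite sqr_ge0.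
rewrite exprMn; have := cauchy_schwarz_row th z; have := qform1_ge0 z.
set a := bilin _ _ _; set p := qform _ th; set r := qform _ z => r0 h.
apply: (@le_trans _ _ (lam ^+ 2 * (p * r))).
  by rewrite ler_wpM2l ?sqr_ge0.
have -> : lam ^+ 2 * (p * r) = (lam * p) * (lam * r) by ring.
by rewrite -[leRHS]mul1r ler_wpM2r // mulr_ge0 // ltW.
Qed.

End LinearAlgebra.

(** * The lower bound *)

Section RunLocality.
Variables (R : realType) (d : nat) (alg : policy R d) (x : nat -> 'rV[R]_d) (u : nat -> R).

Lemma qhist_ge (y : nat -> R) t s : (t <= s)%N -> qhist alg x y u t s = false.
Proof.
by elim: t => //= t IH ts; rewrite gtn_eqF ?IH // ltnW.
Qed.

Lemma qhist_lt (y : nat -> R) t s : (s < t)%N -> qhist alg x y u t s = query_at alg x y u s.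
Proof.
elim: t => //= t IH; rewrite ltnS leq_eqVlt => /orP[/eqP ->|st]; first by rewrite eqxx.
by rewrite ltn_eqF // IH.
Qed.

(** A label that was not queried reaches the policy as 0, so agreement is asked only where the first
    run queries. *)
Lemma run_ext (y y' : nat -> R) t :
  (forall s, (s < t)%N -> query_at alg x y u s -> y s = y' s) ->
  [/\ qhist alg x y u t = qhist alg x y' u t,
      pred_at alg x y u t = pred_at alg x y' u t &
      query_at alg x y u t = query_at alg x y' u t].
Proof.
move=> yy'.
have stepE r : (r <= t)%N -> qhist alg x y u r = qhist alg x y' u r ->
    step alg x y u r (qhist alg x y u r) = step alg x y' u r (qhist alg x y' u r).
  move=> rt e; rewrite -e /step; congr (alg r _ _ _ _); apply: funext => s.
  case: ifP => // qs; apply: yy'.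
    by rewrite (leq_trans _ rt) // ltnNge; apply/negP => /(qhist_ge y); rewrite qs.
  by rewrite -(@qhist_lt _ r) // ltnNge; apply/negP => /(qhist_ge y); rewrite qs.
have H r : (r <= t)%N -> qhist alg x y u r = qhist alg x y' u r.
  elim: r => // r IH rt; apply: funext => s /=.
  by rewrite -stepE ?IH // ltnW.
by split; [exact: H | rewrite /pred_at stepE ?H | rewrite /query_at stepE ?H].
Qed.

End RunLocality.

(** * The harmonic mean as a potential *)

Section Harmonic.
Variable R : realFieldType.
Implicit Types a b e p v : R.

(** Up to the factor [4 v^2], the least value of [a (p - v)^2 + b (p + v)^2] over [p], attained at
    the posterior mean [(a - b) v / (a + b)]. *)
Definition harm a b := a * b / (a + b).

Lemma harm_quad a b p v : 0 < a -> 0 < b ->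
  4 * v ^+ 2 * harm a b <= a * (p - v) ^+ 2 + b * (p + v) ^+ 2.
Proof.
move=> a0 b0; have s0 : 0 < a + b by rewrite addr_gt0.
rewrite /harm mulrA ler_pdivrMr // -subr_ge0.
rewrite (_ : _ - _ = ((a + b) * p - (a - b) * v) ^+ 2) ?sqr_ge0 //; ring.
Qed.

Lemma harm_le a b : 0 < a -> 0 < b -> harm a b <= (a + b) / 4.
Proof.
move=> a0 b0; have s0 : 0 < a + b by rewrite addr_gt0.
rewrite /harm ler_pdivrMr // -subr_ge0.
rewrite (_ : _ - _ = ((a - b) / 2) ^+ 2) ?sqr_ge0 //; by field.
Qed.

Lemma harm_ge0 a b : 0 < a -> 0 < b -> 0 <= harm a b.
Proof. by move=> a0 b0; rewrite divr_ge0 ?mulr_ge0 ?addr_ge0 ?ltW. Qed.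

(** A label multiplies the weights by its likelihoods. Both sides reduce to fractions with numerator
    [(1 - e^2) a b (a + b)]; the doubled totals after the two labels sum to [2 (a + b)], so their
    product is at most [(a + b)^2]. *)
Lemma harm_split a b e : 0 < a -> 0 < b -> 0 <= e < 1 ->
  (1 - e ^+ 2) * harm a b <=
  harm ((1 + e) / 2 * a) ((1 - e) / 2 * b) + harm ((1 - e) / 2 * a) ((1 + e) / 2 * b).
Proof.
move=> a0 b0 /andP[e0 e1].
have s0 : 0 < a + b by rewrite addr_gt0.
have p1 : 0 < (1 + e) * a + (1 - e) * b.
  by rewrite addr_gt0 // mulr_gt0 //; lra.
have p2 : 0 < (1 - e) * a + (1 + e) * b.
  by rewrite addr_gt0 // mulr_gt0 //; lra.
have -> : harm ((1 + e) / 2 * a) ((1 - e) / 2 * b) + harm ((1 - e) / 2 * a) ((1 + e) / 2 * b)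
   = (1 - e ^+ 2) * (a * b) * (a + b) / (((1 + e) * a + (1 - e) * b) * ((1 - e) * a + (1 + e) * b)).
  rewrite /harm; field; rewrite !gt_eqF //=.
have -> : (1 - e ^+ 2) * harm a b = (1 - e ^+ 2) * (a * b) * (a + b) / ((a + b) * (a + b)).
  by rewrite /harm; field; rewrite gt_eqF.
rewrite ler_wpM2l //.
  rewrite mulr_ge0 ?(ltW s0) // mulr_ge0 ?mulr_ge0 ?(ltW a0) ?(ltW b0) //.
  by rewrite subr_ge0 expr_le1 // ltW.
rewrite lef_pV2 ?posrE ?mulr_gt0 // -subr_ge0.
rewrite (_ : _ - _ = (e * (a - b)) ^+ 2) ?sqr_ge0 //; ring.
Qed.

End Harmonic.

Section AllWords.
Variable X : finType.

(** Sequences rather than tuples, so that [sum_words] peels off the first letter in step with the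
    rounds of a game. *)
Fixpoint words n : seq (seq X) :=
  if n is n'.+1 then [seq k :: ks | k <- index_enum X, ks <- words n'] else [:: [::]].

Lemma size_words n : size (words n) = (#|X| ^ n)%N.
Proof.
elim: n => // n IH; rewrite /= size_allpairs IH expnS; congr muln.
by rewrite cardE /= enumT.
Qed.

Lemma sum_words (R : nmodType) n (F : seq X -> R) :
  \sum_(ks <- words n.+1) F ks = \sum_k \sum_(ks <- words n) F (k :: ks).
Proof. by rewrite /= big_allpairs_dep. Qed.

End AllWords.

(** * The two-sign game for one coordinate *)

Section Game.
Variables (R : realType) (d : nat) (alg : policy R d) (x : nat -> 'rV[R]_d) (u : nat -> R).
Variables (c : R) (X : finType) (x0 : X) (I : pred nat) (lbl : bool -> nat -> X -> R) (e l : R).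
Hypotheses (c0 : 0 <= c) (e01 : 0 <= e < 1).
Let m : R := #|X|%:R.
Let sg (s : bool) : R := if s then 1 else -1.
Hypothesis lblI : forall s t (F : R -> R), I t ->
  \sum_k F (lbl s t k) = m * ((1 + sg s * e) / 2 * F l + (1 - sg s * e) / 2 * F (- l)).
Hypothesis lblO : forall t, ~~ I t -> lbl true t = lbl false t.

Let upd (y : nat -> R) t v : nat -> R := fun r => if r == t then v else y r.

Definition labels s (y : nat -> R) t ks : nat -> R :=
  fun r => if (r < t)%N then y r else lbl s r (nth x0 ks (r - t)).

Definition round_cost s (y : nat -> R) r : R :=
  if I r then c * (pred_at alg x y u r - sg s * (e * l)) ^+ 2 + (query_at alg x y u r)%:R else 0.

(** A sum over all words instead of an average, hence the factors [m ^+ n] below. Rounds outside [I]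
    are priced at 0 but stay in the game, since the policy may react to their labels. *)
Definition cost_to_go s n t (y : nat -> R) : R :=
  \sum_(ks <- words X n) \sum_(t <= r < t + n) round_cost s (labels s y t ks) r.

Lemma labels_cons s y t k ks :
  labels s y t (k :: ks) = labels s (upd y t (lbl s t k)) t.+1 ks.
Proof.
apply: funext => r; rewrite /labels /upd ltnS.
case: ltngtP => [rt|tr|->]; last by rewrite subnn.
- by [].
- by rewrite subnS -[in LHS](prednK (n := r - t)) ?subn_gt0.
Qed.

Lemma round_cost_ext s y y' t :
  (forall r, (r < t)%N -> query_at alg x y u r -> y r = y' r) ->
  round_cost s y t = round_cost s y' t.
Proof. by move=> /run_ext[_ e1 e2]; rewrite /round_cost e1 e2. Qed.

Lemma cost_to_goS s n t y :
  cost_to_go s n.+1 t y =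
  m ^+ n.+1 * round_cost s y t + \sum_k cost_to_go s n t.+1 (upd y t (lbl s t k)).
Proof.
have E k ks : \sum_(t <= r < t + n.+1) round_cost s (labels s y t (k :: ks)) r
    = round_cost s y t
      + \sum_(t.+1 <= r < t.+1 + n) round_cost s (labels s (upd y t (lbl s t k)) t.+1 ks) r.
  rewrite big_ltn; last by rewrite addnS ltnS leq_addr.
  rewrite (@round_cost_ext s _ y); last by move=> r rt _; rewrite /labels rt.
  by rewrite labels_cons addSnnS.
rewrite /cost_to_go sum_words.
transitivity (\sum_(k : X) (m ^+ n * round_cost s y t
    + cost_to_go s n t.+1 (upd y t (lbl s t k)))).
  apply: eq_bigr => k _; rewrite (eq_bigr _ (fun ks _ => E k ks)) big_split /=; congr (_ + _).
  by rewrite big_const_seq count_predT iter_addr_0 size_words -mulr_natl natrX.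
by rewrite big_split /= sumr_const -[X in X + _]mulr_natl mulrA -exprS.
Qed.

Lemma cost_to_go_ext s n t y y' :
  (forall r, (r < t)%N -> query_at alg x y u r -> y r = y' r) ->
  cost_to_go s n t y = cost_to_go s n t y'.
Proof.
move=> yy'; apply: eq_bigr => ks _; apply: eq_big_nat => r /andP[tr _].
apply: round_cost_ext => r' _; rewrite /labels; case: ifP => // r't.
have -> : query_at alg x (labels s y t ks) u r' = query_at alg x y u r'.
  have [|_ _ //] := @run_ext R d alg x u (labels s y t ks) y r'.
  by move=> r2 h _; rewrite /labels (ltn_trans h).
exact: yy'.
Qed.

Lemma cost_to_go_ge n t y a b : 0 < a -> 0 < b ->
  c * (count I (iota t n))%:R * l ^+ 2 * e ^+ 4 <= 1 ->
  m ^+ n * (4 * c * (e * l) ^+ 2 * (count I (iota t n))%:R * harm a b)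
  <= a * cost_to_go true n t y + b * cost_to_go false n t y.
Proof.
have m0 : 0 <= m by rewrite ler0n.
elim: n t y a b => [|n IH] t y a b a0 b0.
  move=> _; rewrite /cost_to_go /= !big_cons !big_nil addn0 !big_geq //=.
  by rewrite mulr0 mul0r !mulr0 !addr0 mulr0 mulr0 addr0.
rewrite /= => hyp; rewrite !cost_to_goS.
have cc : c * (count I (iota t.+1 n))%:R * l ^+ 2 * e ^+ 4 <= 1.
  apply: le_trans hyp; rewrite ler_wpM2r ?exprn_ge0 //; first by case/andP: e01.
  by rewrite ler_wpM2r ?sqr_ge0 // ler_wpM2l // ler_nat leq_addl.
set N := count I (iota t.+1 n) in hyp cc *.
case: (boolP (I t)) hyp => It hyp; last first.
  (* Outside [I] both signs show the same label for each letter, so the weights do not change. *)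
  rewrite /round_cost (negPf It) !mulr0 !add0r lblO // !mulr_sumr -big_split /=.
  rewrite -/m exprS.
  apply: le_trans (ler_sum _ (fun k _ => IH t.+1 (upd y t (lbl false t k)) a b a0 b0 cc)).
  by rewrite sumr_const -[leRHS]mulr_natl -/N -/m add0n -!mulrA.
rewrite /round_cost It; set p := pred_at _ _ _ _ _.
rewrite /sg mul1r mulN1r opprK.
have hq := harm_quad p (e * l) a0 b0.
have h0 := harm_ge0 a0 b0; have h4 := harm_le a0 b0.
have mn : 0 <= m ^+ n.+1 by rewrite exprn_ge0.
rewrite natrD (_ : (nat_of_bool true)%:R = 1 :> R) //.
case: (boolP (query_at alg x y u t)) => qt; last first.
  (* Unqueried, the label at [t] is never read; the prediction alone pays the decrement. *)
  have E s k : cost_to_go s n t.+1 (upd y t (lbl s t k)) = cost_to_go s n t.+1 y.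
    apply/esym/cost_to_go_ext => r; rewrite ltnS leq_eqVlt /upd => /orP[/eqP->|rt].
      by rewrite (negPf qt).
    by rewrite ltn_eqF.
  under eq_bigr => k _ do rewrite E.
  under [X in _ + _ * (_ + X)]eq_bigr => k _ do rewrite E.
  rewrite !sumr_const -!(mulr_natl (cost_to_go _ _ _ _)) -/m !addr0.
  have := ler_wpM2l m0 (IH t.+1 y a b a0 b0 cc); rewrite -/N.
  have := ler_wpM2l mn (ler_wpM2l c0 hq).
  set A := cost_to_go _ _ _ _; set B := cost_to_go _ _ _ _; rewrite !(exprS m n).
  move: (m ^+ n) (harm a b) => mm h; lra.
(* A query shows [l] or [- l]; the induction hypothesis is used once for each, with the weights
   multiplied by the likelihoods. *)
rewrite (@lblI true t (fun v => cost_to_go true n t.+1 (upd y t v)) It).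
rewrite (@lblI false t (fun v => cost_to_go false n t.+1 (upd y t v)) It) /sg mul1r mulN1r !opprK.
have /andP[e0 e1] := e01.
have := IH t.+1 (upd y t l) ((1 + e) / 2 * a) ((1 - e) / 2 * b).
have := IH t.+1 (upd y t (- l)) ((1 - e) / 2 * a) ((1 + e) / 2 * b).
set A := cost_to_go _ _ _ _; set B := cost_to_go _ _ _ _.
set A' := cost_to_go _ _ _ _; set B' := cost_to_go _ _ _ _.
move=> i1 i2.
have {}i1 := i1 ltac:(rewrite mulr_gt0 //; lra) ltac:(rewrite mulr_gt0 //; lra) cc.
have {}i2 := i2 ltac:(rewrite mulr_gt0 //; lra) ltac:(rewrite mulr_gt0 //; lra) cc.
have hs := harm_split a0 b0 e01.
rewrite -/N in i1 i2.
set h1 := harm ((1 + e) / 2 * a) _ in i2 hs; set h2 := harm ((1 - e) / 2 * a) _ in i1 hs.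
set h := harm a b in hq h0 h4 hs *.
have mm0 : 0 <= m ^+ n by rewrite exprn_ge0.
have K0 : 0 <= 4 * c * (e * l) ^+ 2 * N%:R.
  by rewrite mulr_ge0 // mulr_ge0 ?sqr_ge0 // mulr_ge0.
have j1 : m ^+ n * (4 * c * (e * l) ^+ 2 * N%:R * ((1 - e ^+ 2) * h))
    <= (1 + e) / 2 * a * A' + (1 - e) / 2 * b * B' + ((1 - e) / 2 * a * A + (1 + e) / 2 * b * B).
  apply: le_trans (lerD i2 i1); rewrite -mulrDr -mulrDr.
  by rewrite ler_wpM2l // ler_wpM2l.
have {}hq := ler_wpM2l c0 hq.
(* The potential lost to the query is [c N l^2 e^4] times [4 h], hence at most [4 h <= a + b], and
   [a + b] is the weighted price of the query. *)
have j2 : 4 * c * (e * l) ^+ 2 * N%:R * (e ^+ 2 * h) <= a + b.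
  have -> : 4 * c * (e * l) ^+ 2 * N%:R * (e ^+ 2 * h) = (c * N%:R * l ^+ 2 * e ^+ 4) * (4 * h) by ring.
  have h40 : 0 <= 4 * h by rewrite mulr_ge0.
  have := ler_wpM2r h40 cc; lra.
have {j1} := ler_wpM2l m0 j1.
rewrite (_ : (nat_of_bool true)%:R = 1 :> R) //.
have j3 : 4 * c * (e * l) ^+ 2 * (1 + N%:R) * h <=
   4 * c * (e * l) ^+ 2 * N%:R * ((1 - e ^+ 2) * h)
      + (a * (c * (p - e * l) ^+ 2 + 1) + b * (c * (p + e * l) ^+ 2 + 1)).
  move: hq j2; move: ((p - e * l) ^+ 2) ((p + e * l) ^+ 2) ((e * l) ^+ 2) (e ^+ 2) => P1 P2 v w.
  move=> hq j2; lra.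
have {j3} := ler_wpM2l mn j3.
rewrite exprS; move: (c * (p - e * l) ^+ 2 + 1) (c * (p + e * l) ^+ 2 + 1) => W1 W2.
move: (m ^+ n) (4 * c * (e * l) ^+ 2 * N%:R * ((1 - e ^+ 2) * h))
  (4 * c * (e * l) ^+ 2 * (1 + N%:R) * h) => mm V1 V2 j3 j1.
lra.
Qed.

End Game.

(** * From one coordinate to all sign vectors *)

Section AllCoordinates.
Variables (R : realType) (d : nat) (alg : policy R d) (x : nat -> 'rV[R]_d) (u : nat -> R).
Variables (c : R) (X : finType) (x0 : X) (T : nat) (coord : nat -> 'I_d).
Variables (lab : bool -> nat -> X -> R) (e : 'I_d -> R) (l : R).
Hypotheses (c0 : 0 <= c) (e01 : forall i, 0 <= e i < 1).
Let m : R := #|X|%:R.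
Let sg (s : bool) : R := if s then 1 else -1.
Hypothesis labE : forall s t (F : R -> R),
  \sum_k F (lab s t k)
  = m * ((1 + sg s * e (coord t)) / 2 * F l + (1 - sg s * e (coord t)) / 2 * F (- l)).
Hypothesis few : forall i,
  c * (count (fun t => coord t == i) (iota 0 T))%:R * l ^+ 2 * e i ^+ 4 <= 1.
Variable th : {ffun 'I_d -> bool} -> 'rV[R]_d.
Hypothesis thE : forall sigma t, (t < T)%N ->
  dotv (th sigma) (x t) = sg (sigma (coord t)) * (e (coord t) * l).

Let Y (sigma : {ffun 'I_d -> bool}) ks t := lab (sigma (coord t)) t (nth x0 ks t).

(** The cost is additive over coordinates. For coordinate [i] the sign vectors are paired by
    flipping entry [i]; each pair is a two-sign game with weights 1 and 1, in which the rounds of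
    other coordinates do not tell the signs apart. *)
Lemma bayes_cost_ge :
  2 ^+ d * m ^+ T * (\sum_(0 <= t < T) c * l ^+ 2 * e (coord t) ^+ 2)
  <= \sum_(sigma : {ffun 'I_d -> bool}) \sum_(ks <- words X T)
       total_cost alg x (Y sigma ks) u c (th sigma) T.
Proof.
pose G (i : 'I_d) (sigma : {ffun 'I_d -> bool}) : R := \sum_(ks <- words X T)
  \sum_(0 <= t < 0 + T) round_cost alg x u c (fun t => coord t == i) (e i) l (sigma i) (Y sigma ks) t.
have -> : \sum_(sigma : {ffun 'I_d -> bool}) \sum_(ks <- words X T)
       total_cost alg x (Y sigma ks) u c (th sigma) T = \sum_i \sum_sigma G i sigma.
  rewrite [RHS]exchange_big; apply: eq_bigr => sigma _.
  rewrite /G [RHS]exchange_big; apply: eq_bigr => ks _.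
  rewrite [RHS]exchange_big add0n big_mkord.
  rewrite /total_cost /regret /nqueries mulr_sumr -big_split; apply: eq_bigr => t _ /=.
  rewrite (bigD1 (coord t)) //= big1 ?addr0; last first.
    by move=> i /negPf it; rewrite /round_cost eq_sym it.
  by rewrite /round_cost eqxx thE.
pose flip i (sigma : {ffun 'I_d -> bool}) : {ffun 'I_d -> bool} :=
  [ffun j => if j == i then ~~ sigma j else sigma j].
have flipK i : involutive (flip i).
  by move=> sigma; apply/ffunP => j; rewrite !ffunE; case: eqP => // _; rewrite negbK.
pose nI i := count (fun t => coord t == i) (iota 0 T).
have H i (sigma : {ffun 'I_d -> bool}) : m ^+ T * (2 * c * (e i * l) ^+ 2 * (nI i)%:R) <= G i sigma + G i (flip i sigma).
  pose lbl s t k := lab (if coord t == i then s else sigma (coord t)) t k.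
  pose sset s : {ffun 'I_d -> bool} := [ffun j => if j == i then s else sigma j].
  have GE s : G i (sset s)
     = cost_to_go alg x u c x0 (fun t => coord t == i) lbl (e i) l s T 0 (fun=> 0).
    apply: eq_bigr => ks _; apply: eq_bigr => t _.
    have -> : sset s i = s by rewrite ffunE eqxx.
    congr round_cost; apply: funext => r.
    by rewrite /Y /labels /lbl subn0 ffunE.
  have -> : G i sigma + G i (flip i sigma) = G i (sset true) + G i (sset false).
    have e1 : sigma = sset (sigma i).
      by apply/ffunP => j; rewrite ffunE; case: eqP => [->|].
    have e2 : flip i sigma = sset (~~ sigma i).
      by apply/ffunP => j; rewrite !ffunE; case: eqP => [->|].
    by rewrite {1}e1 e2; case: (sigma i) => //=; rewrite addrC.
  rewrite !GE.
  have := @cost_to_go_ge R d alg x u c X x0 (fun t => coord t == i) lbl (e i) l c0 (e01 i) _ _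
    T 0 (fun=> 0) 1 1 ltr01 ltr01 (few i).
  rewrite !mul1r /harm => le1; apply: le_trans (le1 _ _).
  - by rewrite le_eqVlt; apply/orP; left; apply/eqP; rewrite -/(nI i); field.
  - by move=> s t F /eqP it; rewrite /lbl it eqxx labE it.
  - by move=> t /negPf it; rewrite /lbl it.
have H2 i : 2 ^+ d * m ^+ T * (c * (e i * l) ^+ 2 * (nI i)%:R) <= \sum_sigma G i sigma.
  (* [flip i] is a bijection, so the sum over [sigma] counts each pair twice. *)
  have S2 : \sum_sigma G i (flip i sigma) = \sum_sigma G i sigma.
    by rewrite [RHS](reindex_inj (inv_inj (flipK i))).
  have : \sum_(sigma : {ffun 'I_d -> bool}) (m ^+ T * (2 * c * (e i * l) ^+ 2 * (nI i)%:R))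
     <= \sum_sigma (G i sigma + G i (flip i sigma)) by apply: ler_sum => sigma _; apply: H.
  rewrite big_split /= S2 sumr_const card_ffun card_bool card_ord -[leLHS]mulr_natl natrX.
  move: (\sum_sigma _) (2 ^+ d) (m ^+ T) => A B C; lra.
apply: le_trans (ler_sum _ (fun i _ => H2 i)).
rewrite -[leRHS]mulr_sumr ler_wpM2l //; first by rewrite mulr_ge0 ?exprn_ge0.
rewrite le_eqVlt; apply/orP; left; apply/eqP.
transitivity (\sum_(i < d) \sum_(0 <= t < T | coord t == i) c * l ^+ 2 * e i ^+ 2).
  rewrite (exchange_big_dep xpredT) //=; apply: eq_bigr => t _.
  by rewrite (big_pred1 (coord t)) // => i; rewrite /= eq_sym.
apply: eq_bigr => i _; rewrite big_const_seq iter_addr_0 /nI.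
by rewrite /index_iota subn0 -mulr_natr; ring.
Qed.

End AllCoordinates.

Local Open Scope classical_set_scope.

(** * Discretised uniform variables *)

Section Cells.
Variables (R : realType) (n : nat).

Definition cell_itv (k : 'I_n.+1) : set R := `[k%:R / n.+1%:R, k.+1%:R / n.+1%:R[.

(** Points in no cell, among them [z = 1], go to [ord0]; a uniform variable meets them with
    probability 0. *)
Definition cell (z : R) : 'I_n.+1 := odflt ord0 [pick k | `[< cell_itv k z >]].

Lemma cell_itv_disj (j k : 'I_n.+1) z : cell_itv j z -> cell_itv k z -> j = k.
Proof.
have n0 : 0 < n.+1%:R :> R by rewrite ltr0n.
rewrite /cell_itv /= !in_itv /= => /andP[a b] /andP[a' b'].
have := le_lt_trans a b'; have := le_lt_trans a' b.
rewrite !ltr_pM2r ?invr_gt0 // !ltr_nat !ltnS => kj jk.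
by apply/val_inj/eqP; rewrite eqn_leq kj jk.
Qed.

(** Taking out the value at the default [ord0] as a constant makes the formula valid outside the
    cells too; it shows that [f \o cell] is a simple function. *)
Lemma cell_decomp (f : 'I_n.+1 -> R) z :
  f (cell z) = f ord0 + \sum_k (f k - f ord0) * \1_(cell_itv k) z.
Proof.
rewrite /cell; case: pickP => [k /asboolP kz|nz] /=.
  rewrite (bigD1 k) //= big1 ?addr0; last first.
    move=> j /eqP jk; rewrite indicE memNset ?mulr0 //= => jz.
    by apply: jk; apply: cell_itv_disj jz kz.
  by rewrite indicE mem_set // mulr1 addrC subrK.
rewrite big1 ?addr0 // => k _; rewrite indicE memNset ?mulr0 // => kz.
by have := nz k; rewrite asboolT.
Qed.

Lemma measurable_cell_itv k : measurable (cell_itv k).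
Proof. exact: measurable_itv. Qed.

Lemma measurable_cell (f : 'I_n.+1 -> R) : measurable_fun setT (f \o cell).
Proof.
have -> : f \o cell = fun z => f ord0 + \sum_k (f k - f ord0) * \1_(cell_itv k) z.
  by apply: funext => z; rewrite /= cell_decomp.
apply: measurable_funD => //; apply: measurable_sum => k.
apply: measurable_funM => //; apply: measurable_indic; exact: measurable_cell_itv.
Qed.

Variables (dO : measure_display) (O : measurableType dO) (P : probability O R).
Variable Z : O -> R.
Hypothesis uZ : uniform01 P Z.

Lemma prob_cell k : P (Z @^-1` cell_itv k) = (n.+1%:R^-1)%:E.
Proof.
have n0 : 0 < n.+1%:R :> R by rewrite ltr0n.
rewrite uZ.2; last exact: measurable_cell_itv.
have -> : cell_itv k `&` `[0%R, 1%R] = cell_itv k.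
  apply/setIidPl => z; rewrite /cell_itv /= !in_itv /= => /andP[a b].
  apply/andP; split; first by apply: le_trans a; rewrite divr_ge0.
  by apply/ltW/(lt_le_trans b); rewrite ler_pdivrMr // mul1r ler_nat.
rewrite lebesgue_measure_itv /= lte_fin ltr_pM2r ?invr_gt0 // ltr_nat ltnSn.
by rewrite -EFinB -mulrBl -natr1 addrC addKr mul1r.
Qed.

Lemma integrable_cell (f : 'I_n.+1 -> R) : P.-integrable setT (EFin \o (f \o cell \o Z)).
Proof.
have -> : EFin \o (f \o cell \o Z)
    = fun w => ((f ord0)%:E + \sum_k ((f k - f ord0)%:E * (\1_(Z @^-1` cell_itv k) w)%:E))%E.
  apply: funext => w; rewrite /= cell_decomp EFinD -sumEFin; congr (_ + _)%E.
have mA k : measurable (Z @^-1` cell_itv k).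
  by rewrite -[_ @^-1` _]setTI; apply: uZ.1 => //; apply: measurable_cell_itv.
apply: integrableD => //.
  exact: finite_measure_integrable_cst.
apply: integrable_sum => // k _; apply: integrableZl => //; exact: integrable_indic.
Qed.

Lemma expectation_cell (f : 'I_n.+1 -> R) :
  ('E_P[fun w => f (cell (Z w))] = ((\sum_k f k) / n.+1%:R)%:E)%E.
Proof.
have n0 : 0 < n.+1%:R :> R by rewrite ltr0n.
have mA k : measurable (Z @^-1` cell_itv k).
  by rewrite -[_ @^-1` _]setTI; apply: uZ.1 => //; apply: measurable_cell_itv.
have iA k : P.-integrable setT (fun w => ((f k - f ord0)%:E * (\1_(Z @^-1` cell_itv k) w)%:E)%E).
  by apply: integrableZl => //; exact: integrable_indic.
have EA k : (\int[P]_w ((f k - f ord0)%:E * (\1_(Z @^-1` cell_itv k) w)%:E))%E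
    = ((f k - f ord0) / n.+1%:R)%:E.
  rewrite integralZl //; last exact: integrable_indic.
  by rewrite integral_indic // setIT [X in (_ * X)%E](prob_cell k) -EFinM.
rewrite unlock.
have -> : (fun w => (f (cell (Z w)))%:E)
    = fun w => ((f ord0)%:E + \sum_k ((f k - f ord0)%:E * (\1_(Z @^-1` cell_itv k) w)%:E))%E.
  by apply: funext => w; rewrite /= cell_decomp EFinD -sumEFin.
rewrite integralD //; last 2 first.
  exact: finite_measure_integrable_cst.
  exact: integrable_sum.
rewrite integral_cst //= probability_setT mule1 integral_sum //.
rewrite (eq_bigr (fun k => ((f k - f ord0) / n.+1%:R)%:E)) => [|k _]; last exact: EA.
rewrite sumEFin -EFinD; congr EFin.
rewrite -mulr_suml sumrB sumr_const card_ord mulrBl -(mulr_natl (f ord0)).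
by rewrite [_ * f ord0 / _]mulrAC divff ?gt_eqF // mul1r addrC subrK.
Qed.

End Cells.

(** From [(1 - x/2)^2 <= expR (- x)]: multiplied by [1 + x + x^2] the left side exceeds 1 by
    [(x/2)^2 (1 - 3 x + x^2)], and 3/8 lies just below the smaller root of the last factor. *)
Lemma expR_le_quad (R : realType) (x : R) : x <= 3 / 8 -> expR x <= 1 + x + x ^+ 2.
Proof.
move=> x1; have h : 1 - x / 2 <= expR (- x / 2).
  by rewrite mulNr; apply: expR_ge1Dx.
have h0 : 0 <= 1 - x / 2 by lra.
have h2 : (1 - x / 2) ^+ 2 <= expR (- x).
  by rewrite [- x]splitr expRD -expr2 ler_sqr ?nnegrE // expR_ge0.
have q0 : 0 < 1 + x + x ^+ 2 by nra.
have h3 : 1 <= (1 + x + x ^+ 2) * expR (- x).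
  apply: le_trans (ler_wpM2l (ltW q0) h2); rewrite -subr_ge0.
  rewrite (_ : _ - 1 = (x / 2) ^+ 2 * (1 - 3 * x + x ^+ 2)); last by field.
  by rewrite mulr_ge0 ?sqr_ge0 //; nra.
have := ler_wpM2r (expR_ge0 x) h3.
by rewrite mul1r -mulrA -expRD addNr expR0 mulr1.
Qed.

(** The linear term has mean zero for a centred variable, so a bound on its absolute value becomes a
    sub-Gaussian bound. *)
Lemma expR_le_add_expR_sq (R : realType) (x : R) : expR x <= x + expR (4 * x ^+ 2).
Proof.
have [x1|x1] := lerP x (3 / 8).
  have := expR_le_quad x1; have := expR_ge1Dx (4 * x ^+ 2); have := sqr_ge0 x; lra.
apply: (@le_trans _ _ (expR (4 * x ^+ 2))); last by rewrite lerDr; lra.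
by rewrite ler_expR; nra.
Qed.

Section CellNoise.
Variables (R : realType) (n : nat) (dO : measure_display) (O : measurableType dO).
Variables (P : probability O R) (Z : O -> R).
Hypothesis uZ : uniform01 P Z.

(** The bound 5/16 is a label of size 1/4 plus a mean of size at most 1/16, and [4 (5/16)^2 <= 1/2]
    fits the exponent for [eta >= 1]. *)
Lemma subgaussian_cell (v : 'I_n.+1 -> R) (eta : R) : 1 <= eta ->
  \sum_k v k = 0 -> (forall k, `|v k| <= 5 / 16) ->
  measurable_fun setT (v \o @cell R n) /\ subgaussian0 P ((v \o @cell R n) \o Z) eta.
Proof.
move=> eta1 v0 vle.
have n0 : 0 < n.+1%:R :> R by rewrite ltr0n.
have mv := measurable_cell v; split => //; split.
  by apply: measurableT_comp mv _; exact: uZ.1.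
split; first exact: integrable_cell.
split; first by rewrite (expectation_cell uZ v) v0 mul0r.
move=> lam.
rewrite (expectation_cell uZ (fun k => expR (lam * v k))) lee_fin ler_pdivrMr //.
apply: (@le_trans _ _ (\sum_(k < n.+1) (lam * v k + expR (lam ^+ 2 * eta ^+ 2 / 2)))); last first.
  by rewrite big_split /= -mulr_sumr v0 mulr0 add0r sumr_const card_ord -[leLHS]mulr_natr.
apply: ler_sum => k _; apply: le_trans (expR_le_add_expR_sq _) _.
rewrite lerD2l ler_expR.
have h : v k ^+ 2 <= (5 / 16) ^+ 2.
  by rewrite -real_normK ?num_real // ler_sqr ?nnegrE //; apply: vle.
have := sqr_ge0 lam; have : 1 <= eta ^+ 2 by rewrite expr_ge1 // (le_trans ler01).
rewrite exprMn; move: (v k ^+ 2) (lam ^+ 2) (eta ^+ 2) h => a b e h e1 b0; nra.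
Qed.

End CellNoise.

(** * Rotated two-valued labels *)

Section Labels.
Variables (R : realType) (p : nat).
Let N := p.+1.
Let X := 'I_(p.*2.+1).+1.

(** Of the [2 N] cells the first [N + j] or [N - j] carry the upper label, so the bias is exactly
    [j / N]. *)
Definition thr (s : bool) (j : nat) : nat := if s then (N + j)%N else (N - j)%N.

(** Addition in [X] is modulo [2 N]: for a fixed [r] the index [r + k] runs through all cells, so
    the average over [k] needs no randomness in [r]. *)
Lemma sum_label (s : bool) (j : nat) (r : X) (A B : R) : (j <= N)%N ->
  \sum_(k : X) (if ((r + k)%R < thr s j)%N then A else B)
  = #|X|%:R * ((1 + (if s then 1 else -1) * (j%:R / N%:R)) / 2 * A
             + (1 - (if s then 1 else -1) * (j%:R / N%:R)) / 2 * B).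
Proof.
move=> jN.
have N0 : N%:R != 0 :> R by rewrite pnatr_eq0.
have XN : (p.*2.+2 = N + N)%N by rewrite addnn.
rewrite -(reindex_inj (addrI r) (P := xpredT) (F := fun k : X => if (k < thr s j)%N then A else B)).
rewrite -(big_mkord xpredT (fun k => if (k < thr s j)%N then A else B)).
have tN : (thr s j <= p.*2.+2)%N.
  by rewrite XN /thr; case: s; rewrite ?leq_add2l // leq_subLR addnA leq_addl.
rewrite (big_cat_nat _ tN) //=.
rewrite (eq_big_nat _ _ (F2 := fun=> A)); last by move=> k /andP[_ ->].
rewrite [X in _ + X](eq_big_nat _ _ (F2 := fun=> B)); last first.
  by move=> k /andP[tk _]; rewrite ltnNge tk.
rewrite !sumr_const_nat subn0 card_ord -(mulr_natl A) -(mulr_natl B) natrB // XN natrD.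
rewrite /thr; case: s tN => _; rewrite ?natrD ?natrB //; field => //.
Qed.

End Labels.

(** * Rounds and coordinates of the hard environment *)

Section Layout.
Variables (R : realType) (d m : nat) (dd TT : 'I_m -> nat).
Hypotheses (m0 : (0 < m)%N) (dd0 : forall u, (0 < dd u)%N) (TT0 : forall u, (0 < TT u)%N).
Hypothesis ddd : (\sum_(u < m) dd u <= d)%N.
Let T := (\sum_(u < m) TT u)%N.

(** Domain [u] owns [dd u] basis vectors and a block of [TT u] consecutive rounds that runs through
    them cyclically. *)
Lemma domain_layout : exists (dom : nat -> 'I_m) (coord : nat -> 'I_d) (owner : 'I_d -> 'I_m),
  [/\ forall u, #|[pred t : 'I_T | dom t == u]| = TT u,
      forall t, (t < T)%N -> owner (coord t) = dom t,
      forall i, (count (fun t => coord t == i) (iota 0 T)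
                 <= (TT (owner i) %/ dd (owner i)).+1)%N
    & exists B : forall u, 'M[R]_(dd u, d),
        forall t, (t < T)%N -> ((delta_mx 0 (coord t) : 'rV[R]_d) <= B (dom t))%MS].
Proof.
pose u0 := Ordinal m0.
have T0 : (0 < T)%N by rewrite /T (bigD1 u0) //= ltn_addr.
pose oT (t : nat) : 'I_T := insubd (Ordinal T0) t.
have oTE (o : 'I_T) : oT o = o by apply: val_inj; rewrite val_insubd ltn_ord.
pose dom t := tagnat.sig1 (oT t).
pose pos t : 'I_(dd (dom t)) :=
  Ordinal (ltn_pmod (tagnat.sig2 (oT t)) (dd0 (dom t))).
pose coord t : 'I_d := widen_ord ddd (tagnat.Rank (dom t) (pos t)).
pose owner (i : 'I_d) : 'I_m :=
  if insub (val i) is Some o then tagnat.sig1 (o : 'I_(\sum_(u < m) dd u)) else u0.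
have ownE t : owner (coord t) = dom t.
  rewrite /owner (_ : insub (val (coord t)) = Some (tagnat.Rank (dom t) (pos t))); last exact: valK.
  by rewrite tagnat.Rank1K.
exists dom, coord, owner; split => //.
- move=> u; rewrite -[RHS]card_ord -(card_imset xpredT (f := @tagnat.Rank m TT u)); last first.
    by move=> j k /eqP; rewrite -val_eqE tagnat.eq_Rank eqxx /= => /eqP/val_inj.
  apply: eq_card => o; rewrite !inE /dom oTE; apply/eqP/imsetP => [e|[j _ ->]]; last first.
    by rewrite tagnat.Rank1K.
  exists (cast_ord (congr1 TT e) (tagnat.sig2 o)) => //.
  by rewrite -[LHS](tagnat.sig2K o); apply/eqP; rewrite -val_eqE tagnat.eq_Rank [tagnat.sig1 o == u](introT eqP e) /=.
- move=> i; set q := (TT _ %/ _).+1.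
  have -> : count (fun t => coord t == i) (iota 0 T) = #|[pred o : 'I_T | coord o == i]|.
    by rewrite -sum1_count -sum1_card -[RHS](big_mkord (fun t => coord t == i) (fun=> 1%N)) /index_iota subn0.
  rewrite -[q]card_ord.
  (* A round of coordinate [i] is determined by this quotient, because [i] fixes its domain and its
     remainder modulo [dd]. *)
  pose f (o : 'I_T) : 'I_q := inord (tagnat.sig2 o %/ dd (owner i)).
  rewrite -(card_in_imset (f := f)) ?max_card //.
  have fE (o : 'I_T) : coord o = i -> f o = (tagnat.sig2 o %/ dd (owner i))%N :> nat /\ dom o = owner i.
    move=> oi; have e : owner i = dom o by rewrite -oi ownE.
    split => //; rewrite inordK // /q ltnS leq_div2r // e /dom oTE.
    by rewrite ltnW.
  move=> o o'; rewrite !inE => /eqP oi /eqP oi' ff.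
  have [fo eo] := fE _ oi; have [fo' eo'] := fE _ oi'.
  have := congr1 val ff; rewrite /= fo fo' => dv.
  have : coord o == coord o' by rewrite oi oi'.
  rewrite -val_eqE /= tagnat.eq_Rank => /andP[_ /eqP /=]; rewrite eo eo' !oTE => md.
  apply/val_inj; rewrite /= (tagnat.rect o) (tagnat.rect o').
  move: eo eo'; rewrite /dom !oTE => eo eo'; congr (_ + _)%N.
    by apply: eq_bigl => v; rewrite eo eo'.
  by rewrite (divn_eq (tagnat.sig2 o) (dd (owner i))) dv md -divn_eq.
- exists (fun u => \matrix_(k < dd u) delta_mx 0 (widen_ord ddd (tagnat.Rank u k))) => t tT.
  by rewrite -(rowK (fun k => delta_mx 0 (widen_ord ddd (tagnat.Rank (dom t) k))) (pos t)) row_sub.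
Qed.

End Layout.

Lemma total_cost_ext (R : realType) (d : nat) (alg : policy R d) x (y y' u : nat -> R) c th T :
  (forall t, (t < T)%N -> y t = y' t) ->
  total_cost alg x y u c th T = total_cost alg x y' u c th T.
Proof.
move=> yy'; have h t : (t < T)%N -> pred_at alg x y u t = pred_at alg x y' u t /\
    query_at alg x y u t = query_at alg x y' u t.
  by move=> tT; case: (@run_ext R d alg x u y y' t) => // s st _; apply/yy'/(ltn_trans st).
rewrite /total_cost /regret /nqueries; congr (_ * _ + _); apply: eq_bigr => t _.
  by rewrite (h t (ltn_ord t)).1.
by rewrite (h t (ltn_ord t)).2.
Qed.

Lemma total_cost_ge0 (R : realType) (d : nat) (alg : policy R d) x (y u : nat -> R) c th T :
  0 <= c -> 0 <= total_cost alg x y u c th T.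
Proof.
move=> c0; rewrite addr_ge0 ?mulr_ge0 ?sumr_ge0 // => t _; exact: sqr_ge0.
Qed.

(** The sum over the prior is large at every outcome, so some member has large expectation. The
    factor 2 spares a strict comparison of sums and turns 1024 into 2048 later. *)
Lemma exists_integral_ge (R : realType) (dO : measure_display) (O : measurableType dO)
    (P : probability O R) (I : eqType) (s : seq I) (F : I -> O -> R) (B : R) :
  (forall i, measurable_fun setT (F i)) -> (forall i w, 0 <= F i w) ->
  0 < B -> (0 < size s)%N ->
  (forall w, (size s)%:R * (2 * B) <= \sum_(i <- s) F i w) ->
  exists i, (B%:E <= 'E_P[F i])%E.
Proof.
move=> mF F0 B0 s0 hF; apply: contrapT => nex.
have lt i : (\int[P]_w (F i w)%:E <= B%:E)%E.
  rewrite leNgt; apply/negP => h; apply: nex; exists i.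
  by rewrite unlock; apply: ltW.
have : (\int[P]_w ((size s)%:R * (2 * B))%:E <= \int[P]_w (\sum_(i <- s) (F i w)%:E))%E.
  apply: ge0_le_integral => //.
  - by move=> w _; rewrite lee_fin mulr_ge0 // mulr_ge0 // ltW.
  - have -> : (fun w => \sum_(i <- s) (F i w)%:E)%E = EFin \o (fun w => \sum_(i <- s) F i w).
      by apply: funext => w; rewrite /= sumEFin.
    by apply/measurable_EFinP; apply: measurable_sum.
  - by move=> w _; rewrite sumEFin lee_fin.
rewrite integral_cst //= probability_setT mule1 ge0_integral_sum //; last 2 first.
- by move=> i; apply/measurable_EFinP.
- by move=> i w _; rewrite lee_fin.
apply/negP; rewrite -ltNge.
apply: (@le_lt_trans _ _ (\sum_(i <- s) B%:E)); first by apply: lee_sum => i _.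
rewrite sumEFin lte_fin big_const_seq count_predT iter_addr_0 -(mulr_natl B).
by rewrite ltr_pM2l ?ltr0n //; lra.
Qed.

(** * Choice of the bias and the hard environment *)

Section LowerBound.
Variables (R : realType) (d m : nat) (dd TT : 'I_m -> nat) (eta c : R).
Hypotheses (m0 : (0 < m)%N) (dd0 : forall u, (0 < dd u)%N) (TT0 : forall u, (0 < TT u)%N).
Hypothesis ddTT : forall u, (dd u <= TT u)%N.
Hypothesis ddd : (\sum_(u < m) dd u <= d)%N.
Hypothesis eta1 : 1 <= eta.
Hypothesis c_ge : forall u, (dd u)%:R / (TT u)%:R <= c.
Let T := (\sum_(u < m) TT u)%N.

Let c0 : 0 < c.
Proof.
apply: lt_le_trans (c_ge (Ordinal m0)).
by rewrite divr_gt0 // ltr0n ?dd0 ?TT0.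
Qed.

(* The bias of domain [u] is [(d_u / (c T_u))^(1/4) / 4] up to rounding: this balances
   [1 / eps^2] queries per coordinate against a regret [c (T_u / d_u) eps^2]. *)
Lemma bias_choice : exists (p : nat) (j : 'I_m -> nat), forall u,
  let eps := (j u)%:R / p.+1%:R : R in
  [/\ 0 <= eps, eps <= 1 / 4,
      c * (2 * ((TT u)%:R / (dd u)%:R)) * (1 / 4) ^+ 2 * eps ^+ 4 <= 1 &
      Num.sqrt c * Num.sqrt ((TT u)%:R * (dd u)%:R) / 1024
        <= c * (1 / 4) ^+ 2 * eps ^+ 2 * (TT u)%:R].
Proof.
pose q u : R := (dd u)%:R / (c * (TT u)%:R).
have D0 u : 0 < (dd u)%:R :> R by rewrite ltr0n.
have T0 u : 0 < (TT u)%:R :> R by rewrite ltr0n.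
have q0 u : 0 < q u by rewrite divr_gt0 // mulr_gt0.
have q1 u : q u <= 1.
  rewrite ler_pdivrMr ?mulr_gt0 // mul1r.
  by have := c_ge u; rewrite ler_pdivrMr.
pose e0 u : R := Num.sqrt (Num.sqrt (q u)) / 4.
have e00 u : 0 < e0 u by rewrite divr_gt0 // !sqrtr_gt0.
have s1 u : Num.sqrt (q u) <= 1 by rewrite -sqrtr1 ler_sqrt.
have e04 u : e0 u <= 1 / 4 by rewrite ler_wpM2r // -sqrtr1 ler_sqrt.
(* A common denominator exceeding every [1 / e0 u]: rounding [e0 u] down to a multiple of [1 / p.+1]
   then at most halves it. *)
pose p := (\sum_u Num.trunc ((e0 u)^-1))%N.
exists p, (fun u => Num.trunc (p.+1%:R * e0 u)) => u.
set N : R := p.+1%:R; have N0 : 0 < N by rewrite ltr0n.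
have Ne : 1 <= N * e0 u.
  rewrite -ler_pdivrMr // div1r; apply/ltW/(lt_le_trans (truncnS_gt _)).
  by rewrite ler_nat ltnS /p (bigD1 u) //= leq_addr.
have Ne0 : 0 <= N * e0 u by rewrite (le_trans ler01).
have /andP[jle jlt] := truncn_itv Ne0.
have j1 : (1 <= Num.trunc (N * e0 u))%N by rewrite truncn_gt0.
set j := Num.trunc _ in jle jlt j1 *.
have jge : N * e0 u / 2 <= j%:R.
  have : 1 <= j%:R :> R by rewrite ler1n.
  by move: jlt; rewrite -natr1; lra.
move=> eps.
have eps0 : 0 <= eps by rewrite divr_ge0 // ltW.
have epsle : eps <= e0 u by rewrite ler_pdivrMr // mulrC.
have epsge : e0 u / 2 <= eps by rewrite ler_pdivlMr // mulrC mulrA.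
have e0sq : e0 u ^+ 2 = Num.sqrt (q u) / 16.
  rewrite exprMn sqr_sqrtr ?sqrtr_ge0 // exprVn; congr (_ / _).
  by rewrite -natrX.
have e0q : e0 u ^+ 4 = q u / 256.
  rewrite (exprM _ 2 2) e0sq exprMn sqr_sqrtr ?(ltW (q0 u)) // exprVn.
  by rewrite -natrX.
split => //.
- exact: le_trans epsle (e04 u).
- have h4 : eps ^+ 4 <= q u / 256 by rewrite -e0q lerXn2r // nnegrE ?(ltW (e00 u)).
  have K0 : 0 <= c * (2 * ((TT u)%:R / (dd u)%:R)) * (1 / 4) ^+ 2.
    by rewrite !mulr_ge0 ?(ltW c0) ?invr_ge0 // (le_trans ler01).
  apply: le_trans (ler_wpM2l K0 h4) _.
  rewrite [leLHS](_ : _ = 1 / 2048); first by lra.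
  by rewrite /q; field; rewrite !gt_eqF // D0 T0.
(* Here 64 is 16 from [e0 u ^+ 2] times 4 from rounding; the label amplitude adds another 16, and
   [c T_u sqrt (q u) = sqrt (c T_u d_u)]. *)
- have h2 : Num.sqrt (q u) / 64 <= eps ^+ 2.
    have -> : Num.sqrt (q u) / 64 = (e0 u / 2) ^+ 2 by rewrite exprMn e0sq; field.
    by rewrite lerXn2r // nnegrE divr_ge0 // ltW.
  have K0 : 0 <= c * (1 / 4) ^+ 2 by rewrite mulr_ge0 ?sqr_ge0 ?(ltW c0).
  have h3 := ler_wpM2r (ltW (T0 u)) (ler_wpM2l K0 h2).
  apply: le_trans h3.
  have -> : c * (1 / 4) ^+ 2 * (Num.sqrt (q u) / 64) * (TT u)%:R
      = c * (TT u)%:R * Num.sqrt (q u) / 1024 by field.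
  have K1 : 0 <= 1024^-1 :> R by rewrite invr_ge0 ler0n.
  apply: (ler_wpM2r K1); rewrite -sqrtrM ?(ltW c0) //.
  have cT : 0 < c * (TT u)%:R by rewrite mulr_gt0.
  rewrite -[c * (TT u)%:R]ger0_norm ?(ltW cT) // -sqrtr_sqr -sqrtrM ?sqr_ge0 //.
  rewrite le_eqVlt; apply/orP; left; apply/eqP; congr Num.sqrt.
  by rewrite /q; field; rewrite !gt_eqF // T0.
Qed.

Variables (dO : measure_display) (O : measurableType dO) (P : probability O R).
Variables (U Z : nat -> O -> R).
Hypothesis uZ : forall t, (t < T)%N -> uniform01 P (Z t).
Variable alg : policy R d.
Hypothesis malg : forall (th : 'rV[R]_d) (x : nat -> 'rV[R]_d) (xi : nat -> O -> R),
  (forall t, measurable_fun setT (xi t)) ->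
  measurable_fun setT (fun w =>
    total_cost alg x (fun t => dotv th (x t) + xi t w) (fun t => U t w) c th T).

Lemma lower_bound :
  exists (th : 'rV[R]_d) (x : nat -> 'rV[R]_d) (dom : nat -> 'I_m) (g : nat -> R -> R),
    domain_structure dd TT x dom /\
    norm2 th <= Num.sqrt d%:R /\
    (forall t, (t < T)%N -> norm2 (x t) <= 1 /\ `|dotv th (x t)| <= 1) /\
    (forall t, (t < T)%N -> measurable_fun setT (g t) /\ subgaussian0 P (g t \o Z t) eta) /\
    ('E_P[fun w =>
        (total_cost alg x (fun t => dotv th (x t) + g t (Z t w)) (fun t => U t w) c th T)%R]
      >= (2048^-1 * Num.sqrt c * \sum_(u < m) Num.sqrt ((TT u)%:R * (dd u)%:R))%:E)%E.
Proof.
have [p [j hj]] := bias_choice.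
have [dom [coord [owner [domc ownE cnt [B xB]]]]] := @domain_layout R d m dd TT m0 dd0 TT0 ddd.
rewrite -/T in domc ownE cnt xB.
pose N : R := p.+1%:R; have N0 : 0 < N by rewrite ltr0n.
pose X := 'I_(p.*2.+1).+1.
pose sg (s : bool) : R := if s then 1 else -1.
pose e i : R := (j (owner i))%:R / N.
pose l : R := 1 / 4.
have e0 i : 0 <= e i by have [] := hj (owner i).
have e4 i : e i <= 1 / 4 by have [] := hj (owner i).
have jN u : (j u <= p.+1)%N.
  have [_ h _ _] := hj u; rewrite -(ler_nat R).
  by move: h; rewrite ler_pdivrMr // -/N; lra.
pose th (sigma : {ffun 'I_d -> bool}) : 'rV[R]_d := \row_i (sg (sigma i) * (e i * l)).
pose x t : 'rV[R]_d := delta_mx 0 (coord t).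
have dotE sigma t : dotv (th sigma) (x t) = sg (sigma (coord t)) * (e (coord t) * l).
  rewrite /dotv (bigD1 (coord t)) //= big1 ?addr0; last first.
    by move=> i /negPf ic; rewrite !mxE eqxx ic mulr0.
  by rewrite !mxE !eqxx mulr1.
have thn sigma i : `|sg (sigma i) * (e i * l)| <= 1 / 16.
  have -> : `|sg (sigma i) * (e i * l)| = e i * l.
    have sg1 : `|sg (sigma i)| = 1 by rewrite /sg; case: (sigma i); rewrite ?normrN normr1.
    by rewrite normrM sg1 mul1r ger0_norm // mulr_ge0 // divr_ge0.
  by have := e4 i; rewrite /l; lra.
pose label s t (r k : X) : R := if ((r + k)%R < thr p s (j (owner (coord t))))%N then l else - l.
(* The noise is the label minus its mean, so adding the mean returns the label; [r] is the cell of
   [Z t] and [k] the hidden rotation. *)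
pose v sigma (k : X) t (r : X) : R :=
  label (sigma (coord t)) t r k - sg (sigma (coord t)) * (e (coord t) * l).
pose g sigma ks t : R -> R :=
  if (t < T)%N then v sigma (nth ord0 ks t) t \o @cell R _ else cst 0.
have gOK sigma ks t : (t < T)%N ->
    measurable_fun setT (g sigma ks t) /\ subgaussian0 P (g sigma ks t \o Z t) eta.
  move=> tT; rewrite /g tT; apply: subgaussian_cell => //; first exact: uZ.
  - rewrite /v sumrB sumr_const /label.
    under eq_bigr => r _ do rewrite addrC.
    rewrite (sum_label _ _ l (- l) (jN _)) -(mulr_natl (sg (sigma (coord t)) * (e (coord t) * l))) -/N -/(e (coord t)) -/(sg _).
    by apply/eqP; rewrite subr_eq0; apply/eqP; congr (_ * _); field.
  - move=> r; rewrite /v; apply: le_trans (ler_normB _ _) _.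
    have := thn sigma (coord t); have -> : `|label (sigma (coord t)) t r (nth ord0 ks t)| = 1 / 4.
      by rewrite /label; case: ifP => _; rewrite ?normrN ger0_norm // /l divr_ge0.
    by lra.
have mg sigma ks t : measurable_fun setT (g sigma ks t \o Z t).
  have [tT|tT] := ltnP t T; first by case: (gOK sigma ks t tT) => _ [].
  by rewrite /g ltnNge tT /=; apply: measurable_cst.
pose F (i : {ffun 'I_d -> bool} * seq X) w : R :=
  total_cost alg x (fun t => dotv (th i.1) (x t) + g i.1 i.2 t (Z t w)) (fun t => U t w) c (th i.1) T.
pose s := [seq (sigma, ks) | sigma <- index_enum {ffun 'I_d -> bool}, ks <- words X T].
pose B0 : R := 2048^-1 * Num.sqrt c * \sum_(u < m) Num.sqrt ((TT u)%:R * (dd u)%:R).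
have B00 : 0 < B0.
  have k0 : 0 < 2048^-1 :> R by rewrite invr_gt0 ltr0n.
  have sc : 0 < Num.sqrt c by rewrite sqrtr_gt0.
  apply: mulr_gt0; first exact: mulr_gt0 k0 sc.
  rewrite (bigD1 (Ordinal m0)) //= ltr_pwDl ?sqrtr_gt0 ?mulr_gt0 ?ltr0n ?dd0 ?TT0 //.
  by rewrite sumr_ge0 // => u _; rewrite sqrtr_ge0.
have sizes : (size s)%:R = 2 ^+ d * #|X|%:R ^+ T :> R.
  rewrite /s size_allpairs size_words natrM natrX; congr (_ * _).
  have -> : size (index_enum {ffun 'I_d -> bool}) = #|{ffun 'I_d -> bool}|.
    by rewrite cardE enumT.
  by rewrite card_ffun card_bool card_ord natrX.
have [|||||i hi] := @exists_integral_ge R dO O P _ s F B0.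
- by move=> i; apply: malg => t; apply: mg.
- by move=> i w; apply: total_cost_ge0; rewrite ltW.
- exact: B00.
- by rewrite -(ltr_nat R) sizes mulr_gt0 ?exprn_gt0 // ltr0n card_ord.
(* The outcome [w] is fixed here: seeds and cells are constants, and only signs and rotations are
   averaged. *)
- move=> w; rewrite /s big_allpairs_dep sizes.
  have := @bayes_cost_ge R d alg x (fun t => U t w) c X ord0 T coord
    (fun s t k => label s t (cell _ (Z t w)) k) e l (ltW c0) _ _ _ th (fun sigma t _ => dotE sigma t).
  move=> bayes; apply: le_trans (le_trans (bayes _ _ _) _).
  + rewrite ler_wpM2l ?mulr_ge0 ?exprn_ge0 // big_mkord.
    rewrite (eq_bigr (fun t : 'I_T => c * (1 / 4) ^+ 2 * ((j (dom t))%:R / N) ^+ 2)); last first.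
      by move=> t _; rewrite /e ownE.
    rewrite (partition_big (fun t : 'I_T => dom t) xpredT) //=.
    rewrite (_ : 2 * B0 = \sum_u Num.sqrt c * Num.sqrt ((TT u)%:R * (dd u)%:R) / 1024); last first.
      rewrite /B0 -mulr_suml -mulr_sumr; by field.
    apply: ler_sum => u _; have [_ _ _ h] := hj u; apply: le_trans h _.
    rewrite (eq_bigr (fun=> c * (1 / 4) ^+ 2 * ((j u)%:R / N) ^+ 2)); last first.
      by move=> t /eqP ->.
    by rewrite sumr_const domc -[leRHS]mulr_natr.
  + move=> i; rewrite e0 /=; apply: le_lt_trans (e4 i) _; lra.
  + move=> s' t G; have := @sum_label R p s' (j (owner (coord t))) (cell _ (Z t w)) (G l) (G (- l)) (jN _).
    rewrite -/N -/(e (coord t)) => <-; apply: eq_bigr => k _; rewrite /label.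
    by case: ifP.
  + move=> i; have [_ _ h _] := hj (owner i); apply: le_trans h.
    rewrite -/N -/(e i) ler_wpM2r ?exprn_ge0 // ler_wpM2r ?sqr_ge0 // ler_wpM2l ?(ltW c0) //.
    (* Since [d_u <= T_u], the count per coordinate is at most [2 T_u / d_u], as [bias_choice]
       expects. *)
    have dk : 0 < (dd (owner i))%:R :> R by rewrite ltr0n.
    have cn : ((count (fun t => coord t == i) (iota 0 T))%:R : R)
        <= ((TT (owner i)) %/ (dd (owner i)))%:R + 1.
      by rewrite natr1 ler_nat cnt.
    apply: le_trans cn _.
    have h1 : 1 <= (TT (owner i))%:R / (dd (owner i))%:R :> R.
      by rewrite ler_pdivlMr // mul1r ler_nat.
    have h2 : (TT (owner i) %/ dd (owner i))%:R <= (TT (owner i))%:R / (dd (owner i))%:R :> R.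
      by rewrite ler_pdivlMr // -natrM ler_nat leq_trunc_div.
    lra.
  + rewrite le_eqVlt; apply/orP; left; apply/eqP.
    apply: eq_bigr => sigma _; apply: eq_bigr => ks _; rewrite /F /=.
    apply: total_cost_ext => t tT.
    by rewrite dotE /g tT /= /v addrC subrK.
exists (th i.1), x, dom, (g i.1 i.2); split; [|split; [|split; [|split]]].
- split; last by exists B.
  by move=> u; rewrite -[RHS]domc; apply: eq_card => t; rewrite !inE; apply/asboolP/idP.
- rewrite /norm2 ler_wsqrtr // /dotv -[leRHS]mulr1 mulr_natl -[d in leRHS]card_ord -sumr_const.
  apply: ler_sum => k _; rewrite !mxE -expr2 -real_normK ?num_real //.
  by rewrite expr_le1 // (le_trans (thn _ _)) //; lra.
- move=> t tT; split.
    rewrite /norm2 /dotv (bigD1 (coord t)) //= big1 ?addr0; last first.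
      by move=> k /negPf ic; rewrite !mxE eqxx ic mulr0.
    by rewrite !mxE !eqxx mulr1 sqrtr1.
  by rewrite dotE (le_trans (thn _ _)) //; lra.
- by move=> t tT; apply: gOK.
- exact: hi.
Qed.

End LowerBound.

(** * The upper bound *)

Section Independence.
Variables (R : realType) (dO : measure_display) (O : measurableType dO).
Variable P : probability O R.
Import HBSimple HBNNSimple.

Lemma nnsfun_sum (h : {nnsfun R >-> R}) : exists s : seq R,
  (forall r, r \in s -> 0 <= r) /\
  forall z, h z = \sum_(r <- s) r * \1_(h @^-1` [set r]) z.
Proof.
exists (finmap.enum_fset (fset_set (range h))); split.
  by move=> r; rewrite in_fset_set // inE => -[z _ <-].
by move=> z; rewrite {1}(fimfunE h z) fsbig_finite.
Qed.

Lemma integral_indicT (A : set O) : measurable A -> (\int[P]_w (\1_A w)%:E = P A)%E.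
Proof. by move=> mA; rewrite integral_indic // setIT. Qed.

(** Factorisation is assumed for indicators of [Y] only; simple functions increasing to [h] and
    monotone convergence extend it. *)
Lemma integral_mul_of_indic (Y G : O -> R) (K : R) (h : R -> R) (mu : R) :
  measurable_fun setT Y -> measurable_fun setT G -> (forall w, 0 <= G w) ->
  (forall B, measurable B -> (\int[P]_w (\1_B (Y w) * G w)%:E = P (Y @^-1` B) * K%:E)%E) ->
  measurable_fun setT h -> (forall z, 0 <= h z) -> (\int[P]_w (h (Y w))%:E = mu%:E)%E ->
  (\int[P]_w (h (Y w) * G w)%:E = (mu * K)%:E)%E.
Proof.
move=> mY mG G0 hB mh h0 hmu.
have mEh : measurable_fun setT (EFin \o h) by apply/measurable_EFinP.
pose h_ := nnsfun_approx measurableT mEh.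
have mset r n : measurable (h_ n @^-1` [set r] : set R).
  by rewrite -[V in measurable V]setTI; apply: (measurable_funP (h_ n)).
have mpre r n : measurable (Y @^-1` (h_ n @^-1` [set r])).
  by rewrite -[V in measurable V]setTI; apply: mY.
have mhY n : measurable_fun setT (h_ n \o Y).
  by apply: measurableT_comp => //; apply: measurable_funP.
have simple n : (\int[P]_w (h_ n (Y w) * G w)%:E = (\int[P]_w (h_ n (Y w))%:E) * K%:E)%E.
  have [s [s0 hs]] := nnsfun_sum (h_ n).
  pose q r : R := if r \in s then r else 0.
  have q0 r : 0 <= q r by rewrite /q; case: ifP => // /s0.
  have hq z : h_ n z = \sum_(r <- s) q r * \1_(h_ n @^-1` [set r]) z.
    by rewrite hs; apply: eq_big_seq => r rs; rewrite /q rs.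
  have m1 r : measurable_fun setT (fun w => \1_(h_ n @^-1` [set r]) (Y w) : R).
    by apply: (@measurable_indic _ O R setT (Y @^-1` (h_ n @^-1` [set r]))); exact: mpre.
  have e1 : (\int[P]_w (h_ n (Y w))%:E = \sum_(r <- s) (q r)%:E * P (Y @^-1` (h_ n @^-1` [set r])))%E.
    under eq_integral => w _ do rewrite hq -sumEFin.
    rewrite ge0_integral_sum //.
    - apply: eq_bigr => r _; under eq_integral => w _ do rewrite EFinM.
      rewrite ge0_integralZl_EFin //.
      + by congr (_ * _)%E; exact: (integral_indicT (mpre r n)).
      + exact/measurable_EFinP.
    - by move=> r; apply/measurable_EFinP; apply: measurable_funM.
    - by move=> r w _; rewrite lee_fin mulr_ge0.
  have e2 : (\int[P]_w (h_ n (Y w) * G w)%:E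
      = \sum_(r <- s) (q r)%:E * (P (Y @^-1` (h_ n @^-1` [set r])) * K%:E))%E.
    under eq_integral => w _ do rewrite hq mulr_suml -sumEFin.
    rewrite ge0_integral_sum //.
    - apply: eq_bigr => r _; under eq_integral => w _ do rewrite -mulrA EFinM.
      rewrite ge0_integralZl_EFin //.
      + by rewrite hB.
      + by move=> w _; rewrite lee_fin mulr_ge0.
      + by apply/measurable_EFinP; apply: measurable_funM.
    - move=> r; apply/measurable_EFinP; apply: measurable_funM => //.
      exact: measurable_funM.
    - by move=> r w _; rewrite lee_fin !mulr_ge0.
  rewrite e2 e1 ge0_sume_distrl; first by apply: eq_bigr => r _; rewrite muleA.
  by move=> r _; rewrite mule_ge0 // lee_fin.
have nd z : {homo (fun n => (h_ n z)%:E) : m n / (m <= n)%N >-> (m <= n)%E}.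
  by move=> m n mn; rewrite lee_fin; exact/lefP/nd_nnsfun_approx.
have hcvg z : (h_ n z)%:E @[n --> \oo] --> (h z)%:E.
  by apply: (cvg_nnsfun_approx measurableT mEh) => // x _ /=; rewrite lee_fin.
have l1 : (\int[P]_w (h (Y w))%:E)%E = limn (fun n => \int[P]_w (h_ n (Y w))%:E)%E.
  rewrite -monotone_convergence //.
  - by apply: eq_integral => w _; apply/esym/cvg_lim.
  - by move=> n; exact/measurable_EFinP/mhY.
  - by move=> n w _; rewrite lee_fin.
have l2 : (\int[P]_w (h (Y w) * G w)%:E)%E = limn (fun n => \int[P]_w (h_ n (Y w) * G w)%:E)%E.
  rewrite -monotone_convergence //.
  - apply: eq_integral => w _; apply/esym/cvg_lim => //.
    under eq_fun => n do rewrite EFinM.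
    by rewrite EFinM; apply: cvgeZr.
  - by move=> n; apply/measurable_EFinP; exact: measurable_funM (mhY n) mG.
  - by move=> n w _; rewrite lee_fin mulr_ge0.
  - move=> w _ m n mn; rewrite !EFinM; apply: lee_wpmul2r; first by rewrite lee_fin.
    exact: nd.
rewrite l2; under eq_fun => n do rewrite simple.
have cv : (\int[P]_w (h_ n (Y w))%:E)%E @[n --> \oo] --> mu%:E.
  rewrite -hmu l1; apply: ereal_nondecreasing_is_cvgn => m n mn.
  apply: ge0_le_integral => //.
  - by move=> w _; rewrite lee_fin.
  - exact/measurable_EFinP/mhY.
  - exact/measurable_EFinP/mhY.
  - by move=> w _; apply: nd.
by apply/cvg_lim => //; rewrite EFinM; apply: cvgeZr.
Qed.

Variables (I : finType) (X : I -> O -> R).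
Hypothesis indepX : mutually_independent P X.

(** Independence is defined through events, which settles the case of indicators. Induction on the
    number of other factors: one is replaced by an indicator, and [integral_mul_of_indic] puts it
    back. *)
Lemma indep_integral_prod (f : I -> R -> R) (mu : I -> R) :
  (forall i, measurable_fun setT (f i)) -> (forall i z, 0 <= f i z) ->
  (forall i, (\int[P]_w (f i (X i w))%:E = (mu i)%:E)%E) ->
  (\int[P]_w (\prod_i f i (X i w))%:E = (\prod_i mu i)%:E)%E.
Proof.
suff Q n (S : {set I}) (f' : I -> R -> R) (mu' : I -> R) : #|S| = n ->
    (forall i, measurable_fun setT (f' i)) -> (forall i z, 0 <= f' i z) ->
    (forall i, (\int[P]_w (f' i (X i w))%:E = (mu' i)%:E)%E) ->
    (forall i, i \notin S -> exists2 B, measurable B & f' i = \1_B) ->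
    (\int[P]_w (\prod_i f' i (X i w))%:E = (\prod_i mu' i)%:E)%E.
  move=> mf f0 hmu; apply: (Q _ [set: I]%SET f mu erefl) => // i.
  by rewrite inE.
have mX i : measurable_fun setT (X i) by apply: indepX.1.
elim: n S f' mu' => [|n IH] S g nu cS mg g0 hnu hS.
  have {}hS i : exists B, measurable B /\ g i = \1_B.
    have [|B mB ->] := hS i; last by exists B.
    by move/eqP: cS; rewrite cards_eq0 => /eqP ->; rewrite inE.
  have [B hB] := choice hS.
  have mXB i : measurable (X i @^-1` B i).
    by rewrite -[V in measurable V]setTI; apply: mX => //; case: (hB i).
  have nuE i : P (X i @^-1` B i) = (nu i)%:E.
    by rewrite -hnu (hB i).2; exact/esym/(integral_indicT (mXB i)).
  have E : (fun w => (\prod_i g i (X i w))%:E) = fun w => (\1_[set w | forall i, i \in [set: I]%SET -> B i (X i w)] w)%:E.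
    apply: funext => w; congr EFin; rewrite indicE.
    have [/set_mem /= h|/negP h] := boolP (w \in _).
      by rewrite big1 // => i _; rewrite (hB i).2 indicE mem_set //; apply: h; rewrite inE.
    have [i hi] : exists i, ~ B i (X i w).
      apply/not_existsP => h'; apply: h; apply/mem_set => i _.
      by apply: contrapT; exact: h'.
    by rewrite (bigD1 i) //= (hB i).2 indicE memNset // mul0r.
  rewrite E.
  have -> : (\int[P]_w (\1_[set w0 | forall i : I, i \in [set: I]%SET -> B i (X i w0)] w)%:E)%E
     = P [set w0 | forall i : I, i \in [set: I]%SET -> B i (X i w0)].
    apply: integral_indicT.
    have -> : [set w0 | forall i : I, i \in [set: I]%SET -> B i (X i w0)]
        = \bigcap_(i in [set: I]) (X i @^-1` B i).
      by apply/seteqP; split => w /= h i; [move=> _; apply: h; rewrite inE | move=> _; apply: h].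
    by apply: fin_bigcap_measurable.
  rewrite indepX.2; last by move=> i; case: (hB i).
  rewrite (eq_bigr (fun i => (nu i)%:E)) => [|i _]; last exact: nuE.
  rewrite (eq_bigl xpredT) => [|i]; last by rewrite inE.
  by rewrite (big_morph EFin (fun x y => EFinM x y) (erefl 1%E)).
have /card_gt0P[i0 i0S] : (0 < #|S|)%N by rewrite cS.
pose K := \prod_(i | i != i0) nu i.
pose G w := \prod_(i | i != i0) g i (X i w).
have mG : measurable_fun setT G.
  rewrite /G; under eq_fun => w do rewrite big_mkcond.
  apply: measurable_prod => i _; case: (i != i0) => //.
  exact: measurableT_comp.
under eq_integral => w _ do rewrite (bigD1 i0) //= -/(G w).
rewrite (bigD1 i0) //= -/K.
apply: integral_mul_of_indic => //.
- by move=> w; rewrite prodr_ge0.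
- move=> B mB.
  pose g' i : R -> R := if i == i0 then \1_B else g i.
  have mXB : measurable (X i0 @^-1` B) by rewrite -[V in measurable V]setTI; apply: mX.
  pose nu' i : R := if i == i0 then fine (P (X i0 @^-1` B)) else nu i.
  have nuE : \prod_i nu' i = fine (P (X i0 @^-1` B)) * K.
    rewrite (bigD1 i0) //= {1}/nu' eqxx; congr (_ * _).
    by apply: eq_bigr => i /negPf ii0; rewrite /nu' ii0.
  have := IH (S :\ i0)%SET g' nu'.
  rewrite nuE EFinM fineK ?fin_num_measure // => <-.
  + apply: eq_integral => w _; congr EFin; rewrite (bigD1 i0) //= {1}/g' eqxx; congr (_ * _).
    by apply: eq_bigr => i /negPf ii0; rewrite /g' ii0.
  + by move: cS; rewrite (cardsD1 i0) i0S add1n => -[].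
  + by move=> i; rewrite /g'; case: ifP => // _; apply: measurable_indic.
  + by move=> i z; rewrite /g'; case: ifP => // _; rewrite indicE.
  + move=> i; rewrite /g' /nu'; case: eqP => [->|_]; last exact: hnu.
    by rewrite fineK ?fin_num_measure //; exact: (integral_indicT mXB).
  + move=> i; rewrite !inE negb_and negbK /g'; case: eqP => [_ _|_ /=]; first by exists B.
    exact: hS.
Qed.

End Independence.

(** * Sub-Gaussian tail on a product event of the coins *)

Section NoiseTail.
Variables (R : realType) (dO : measure_display) (O : measurableType dO).
Variables (P : probability O R) (T : nat) (xi U : nat -> O -> R) (eta : R).
Hypothesis eta0 : 0 < eta.
Hypothesis indepXU : indep_pair P T xi U.
Hypothesis subg : forall t, (t < T)%N -> subgaussian0 P (xi t) eta.
Variables (B : 'I_T -> set R) (pB : 'I_T -> R).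
Hypothesis mB : forall t, measurable (B t).
Hypothesis PB : forall t : 'I_T, P (U t @^-1` B t) = (pB t)%:E.

Let mXU : (forall t : 'I_T, measurable_fun setT (xi t)) /\ (forall t : 'I_T, measurable_fun setT (U t)).
Proof.
by case: indepXU => h _; split => t; [exact: (h (inl t)) | exact: (h (inr t))].
Qed.

Let event := [set w | forall t : 'I_T, B t (U t w)].

Lemma measurable_event : measurable event.
Proof.
have -> : event = \bigcap_(t in [set: 'I_T]) (U t @^-1` B t).
  by apply/seteqP; split => w /= h t => [_|]; apply: h.
apply: fin_bigcap_measurable => // t _.
by rewrite -[V in measurable V]setTI; apply: mXU.2.
Qed.

(** Noise and coins are jointly independent, so the event splits off with its exact probability. *)
Lemma integral_event_exp (a : 'I_T -> R) :
  (\int[P]_w (\1_event w * expR (\sum_t a t * xi t w))%:E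
    <= ((\prod_t pB t) * expR (eta ^+ 2 / 2 * \sum_t a t ^+ 2))%:E)%E.
Proof.
pose f (i : 'I_T + 'I_T) : R -> R :=
  match i with inl t => fun z => expR (a t * z) | inr t => \1_(B t) end.
pose X (i : 'I_T + 'I_T) : O -> R := match i with inl t => xi t | inr t => U t end.
have mf i : measurable_fun setT (f i).
  case: i => t /=; last exact: measurable_indic.
  by apply: measurableT_comp => //; exact: measurable_funM.
have f0 i z : 0 <= f i z by case: i => t /=; rewrite ?expR_ge0 // indicE.
have hle t : (\int[P]_w (expR (a t * xi t w))%:E <= (expR (a t ^+ 2 * eta ^+ 2 / 2))%:E)%E.
  by have [_ [_ [_ h]]] := subg (ltn_ord t); have := h (a t); rewrite unlock.
pose mu (i : 'I_T + 'I_T) : R := match i with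
  | inl t => fine (\int[P]_w (expR (a t * xi t w))%:E) | inr t => pB t end.
have muE i : (\int[P]_w (f i (X i w))%:E = (mu i)%:E)%E.
  case: i => t /=.
    rewrite fineK // ge0_fin_numE; first by apply: le_lt_trans (hle t) _; rewrite ltry.
    by apply: integral_ge0 => w _; rewrite lee_fin expR_ge0.
  rewrite -PB; apply: integral_indicT.
  by rewrite -[V in measurable V]setTI; apply: mXU.2.
have := indep_integral_prod indepXU mf f0 muE.
have E w : \1_event w * expR (\sum_t a t * xi t w) = \prod_i f i (X i w).
  rewrite big_sumType /= mulrC expR_sum; congr (_ * _).
  rewrite indicE; have [/set_mem h|/negP h] := boolP (w \in event).
    by rewrite big1 // => t _; rewrite indicE mem_set //; apply: h.
  have [t ht] : exists t, ~ B t (U t w).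
    apply/not_existsP => h'; apply: h; apply/mem_set => t.
    by apply: contrapT; exact: h'.
  by rewrite (bigD1 t) //= indicE memNset // mul0r.
under eq_integral => w _ do rewrite -E.
move=> ->; rewrite lee_fin big_sumType /= mulrC.
have pB0 t : 0 <= pB t by rewrite -lee_fin -PB measure_ge0.
rewrite ler_wpM2l ?prodr_ge0 // mulr_sumr expR_sum.
apply: ler_prod => t _; apply/andP; split.
  by apply: fine_ge0; apply: integral_ge0 => w _; rewrite lee_fin expR_ge0.
rewrite -lee_fin -[leLHS]/((mu (inl t))%:E) -muE.
apply: le_trans (hle t) _; rewrite lee_fin ler_expR le_eqVlt; apply/orP; left; apply/eqP; ring.
Qed.

Lemma noise_tail (a : 'I_T -> R) (v ell : R) : \sum_t a t ^+ 2 <= v -> 0 <= ell ->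
  (P (event `&` [set w | (eta * Num.sqrt (2 * ell * v) < \sum_t a t * xi t w)%R])
    <= ((\prod_t pB t) * expR (- ell))%:E)%E.
Proof.
move=> av l0.
have a0 : 0 <= \sum_t a t ^+ 2 by apply: sumr_ge0 => t _; exact: sqr_ge0.
have pB0 t : 0 <= pB t by rewrite -lee_fin -PB measure_ge0.
have mN : measurable_fun setT (fun w => \sum_t a t * xi t w).
  apply: measurable_sum => t; apply: measurable_funM => //; exact: mXU.1.
have mev2 : measurable [set w | (eta * Num.sqrt (2 * ell * v) < \sum_t a t * xi t w)%R].
  rewrite -[V in measurable V]setTI; apply: (@measurable_fun_ltr _ _ _ setT (cst _)) => //.
(* If [v <= 0] all coefficients vanish, and the strict inequality makes the event empty. *)
have [v0|v0] := lerP v 0.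
  have z : \sum_t a t ^+ 2 = 0 by apply/eqP; rewrite eq_le a0 (le_trans av v0).
  have az t : a t = 0.
    apply/eqP; rewrite -sqrf_eq0; move: z => /eqP; rewrite psumr_eq0; last by move=> s _; exact: sqr_ge0.
    by move=> /allP/(_ t); rewrite mem_index_enum => /(_ isT).
  have -> : [set w | (eta * Num.sqrt (2 * ell * v) < \sum_t a t * xi t w)%R] = set0.
    apply/seteqP; split => // w /=; rewrite big1 => [|t _]; last by rewrite az mul0r.
    by apply/negP; rewrite -leNgt mulr_ge0 ?sqrtr_ge0 // ltW.
  by rewrite setI0 measure0 lee_fin mulr_ge0 ?expR_ge0 ?prodr_ge0.
set N := fun w => \sum_t a t * xi t w.
(* The Chernoff parameter for which [lam * r = 2 ell] while the moment bound costs only [ell]. *)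
pose lam := Num.sqrt (2 * ell / v) / eta.
have lam0 : 0 <= lam by rewrite divr_ge0 ?sqrtr_ge0 // ltW.
have lam2 : lam ^+ 2 * eta ^+ 2 * v = 2 * ell.
  have h0 : 0 <= 2 * ell / v by rewrite divr_ge0 ?mulr_ge0 // ltW.
  by rewrite /lam exprMn sqr_sqrtr // exprVn; field; rewrite !gt_eqF.
set r := eta * Num.sqrt (2 * ell * v) in mev2 *.
have lamr : lam * r = 2 * ell.
  have h0 : 0 <= 2 * ell / v by rewrite divr_ge0 ?mulr_ge0 // ltW.
  rewrite /lam /r mulrA mulfVK ?gt_eqF // -sqrtrM //.
  have -> : 2 * ell / v * (2 * ell * v) = (2 * ell) ^+ 2 by field; rewrite gt_eqF.
  by rewrite sqrtr_sqr ger0_norm // mulr_ge0.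
have mA : measurable (event `&` [set w | r < N w]) by apply: measurableI => //; exact: measurable_event.
rewrite -integral_indicT //.
have mg : measurable_fun setT (fun w => \1_event w * expR (\sum_t (lam * a t) * xi t w) : R).
  apply: measurable_funM; first by apply: measurable_indic; exact: measurable_event.
  apply: measurableT_comp => //; apply: measurable_sum => t; apply: measurable_funM => //.
  exact: mXU.1.
apply: (@le_trans _ _ (\int[P]_w ((expR (- (2 * ell)))%:E
    * (\1_event w * expR (\sum_t (lam * a t) * xi t w))%:E))%E).
  apply: ge0_le_integral => //.
  - by apply/measurable_EFinP; apply: measurable_indic.
  - by apply/measurable_EFinP; apply: measurable_funM.
  - move=> w _; rewrite -EFinM lee_fin !indicE.
    rewrite in_setI; case: (boolP (w \in event)) => hw /=; last by rewrite mul0r mulr0.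
    rewrite mul1r -expRD; have [/set_mem /= rw|_] := boolP (w \in _); last exact: expR_ge0.
    rewrite -[leLHS]expR0 ler_expR.
    have -> : \sum_t lam * a t * xi t w = lam * N w.
      by rewrite /N mulr_sumr; apply: eq_bigr => t _; rewrite mulrA.
    have h : r <= N w by exact: ltW.
    by have := ler_wpM2l lam0 h; rewrite lamr; move: (N w) => Nw; lra.
rewrite (ge0_integralZl_EFin P measurableT _ _ (expR_ge0 _)); last 2 first.
- by move=> w _; rewrite lee_fin mulr_ge0 ?expR_ge0 // indicE.
- exact/measurable_EFinP.
apply: le_trans (lee_wpmul2l _ (integral_event_exp (fun t => lam * a t))) _.
  by rewrite lee_fin expR_ge0.
rewrite -EFinM lee_fin mulrCA ler_wpM2l ?prodr_ge0 // -expRD ler_expR.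
have -> : \sum_t (lam * a t) ^+ 2 = lam ^+ 2 * \sum_t a t ^+ 2.
  by rewrite mulr_sumr; apply: eq_bigr => t _; rewrite exprMn.
have le0 : 0 <= lam ^+ 2 * eta ^+ 2 by rewrite mulr_ge0 // sqr_ge0.
have := ler_wpM2l le0 av; rewrite lam2; move: (\sum_t _) => S; lra.
Qed.

End NoiseTail.

(** A supermartingale without conditional expectations: [W h k] weighs the letter [k] after the
    prefix [h], and later letters are summed out first. *)
Lemma sum_words_prod_le1 (R : numDomainType) (W : seq bool -> bool -> R) n (h : seq bool) :
  (forall h k, 0 <= W h k) -> (forall h, W h false + W h true <= 1) ->
  \sum_(b <- words bool n) \prod_(t < n) W (h ++ take t b) (nth false b t) <= 1.
Proof.
move=> W0 W1; elim: n h => [|n IH] h.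
  by rewrite /= big_cons big_nil big_ord0 addr0.
rewrite sum_words; apply: le_trans (W1 h).
rewrite big_bool /= addrC.
have E k : \sum_(b <- words bool n) \prod_(t < n.+1) W (h ++ take t (k :: b)) (nth false (k :: b) t)
    = W h k * \sum_(b <- words bool n) \prod_(t < n) W (rcons h k ++ take t b) (nth false b t).
  rewrite mulr_sumr; apply: eq_bigr => b _; rewrite big_ord_recl /= cats0; congr (_ * _).
  by apply: eq_bigr => t _; rewrite cat_rcons.
by rewrite !E lerD // ler_piMr.
Qed.

(** * Elementary inequalities *)

Section RealInequalities.
Variable R : realType.
Implicit Types p lam v : R.

(** Giving up half of the mean removes the variance term: [expR (- lam) <= 1 - lam / 2] on the unit
    interval. *)
Lemma bernoulli_mgf_lower p lam : 0 <= p <= 1 -> 0 <= lam <= 1 ->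
  (1 - p) * expR (lam * (p / 2)) + p * expR (lam * (p / 2 - 1)) <= 1.
Proof.
move=> /andP[p0 p1] /andP[l0 l1].
have h1 : expR (- lam) <= 1 - lam / 2.
  have e0 := expR_ge0 (- lam); have h := expR_ge1Dx lam.
  have := ler_wpM2r e0 h; rewrite -expRD subrr expR0 => h2.
  nra.
have h2 := expR_ge1Dx (- (lam * (p / 2))).
have -> : lam * (p / 2 - 1) = lam * (p / 2) + - lam by ring.
rewrite expRD; set E := expR (lam * (p / 2)).
have E0 : 0 <= E by exact: expR_ge0.
have EE : E * expR (- (lam * (p / 2))) = 1 by rewrite -expRD subrr expR0.
have : (1 - p) + p * expR (- lam) <= expR (- (lam * (p / 2))).
  have := ler_wpM2l p0 h1; lra.
move=> /(ler_wpM2l E0); rewrite EE; lra.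
Qed.

Lemma expR1_le3 : expR 1 <= 3 :> R.
Proof.
(* [expR_le_quad] stops at 3/8, so the exponent is cut into quarters; [(21/16)^4 < 3]. *)
have h : expR (1 / 4) <= 21 / 16 :> R.
  have : (1 / 4 : R) <= 3 / 8 by lra.
  by move=> /expR_le_quad h; apply: (le_trans h); lra.
have -> : expR 1 = expR (1 / 4 + 1 / 4 + 1 / 4 + 1 / 4) :> R by congr expR; lra.
rewrite !expRD; set E := expR _ in h *.
have E0 : 0 <= E by exact: expR_ge0.
have E2 : E * E <= (21 / 16) ^+ 2 by nra.
have EE0 : 0 <= E * E by rewrite mulr_ge0.
have -> : E * E * E * E = (E * E) * (E * E) by ring.
nra.
Qed.

(** Doubling the mean suffices, since [1 - p + p * expR 1 <= 1 + 2 p]. *)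
Lemma bernoulli_mgf_upper p : 0 <= p <= 1 ->
  (1 - p) * expR (- (2 * p)) + p * expR (1 - 2 * p) <= 1.
Proof.
move=> /andP[p0 p1]; rewrite expRD; set E := expR (- (2 * p)).
have E0 : 0 <= E by exact: expR_ge0.
have h : 1 + 2 * p <= expR (2 * p) by exact: expR_ge1Dx.
have EE : E * expR (2 * p) = 1 by rewrite -expRD addNr expR0.
have h3 := ler_wpM2l p0 expR1_le3.
have : (1 - p) + p * expR 1 <= expR (2 * p) by lra.
move=> /(ler_wpM2l E0); rewrite EE; lra.
Qed.

(** For the capped value, [expR (w / 2) <= 1 / (1 - w / 2) <= 1 + w]. This turns the product of the
    elliptic potential into a sum of capped widths. *)
Lemma min1_le_ln v : 0 <= v -> Num.min 1 v <= 2 * ln (1 + v).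
Proof.
move=> v0; set w := Num.min 1 v.
have w0 : 0 <= w by rewrite le_min ler01.
have w1 : w <= 1 by rewrite ge_min lexx.
have wv : w <= v by rewrite ge_min lexx orbT.
rewrite -ler_pdivrMl // -[leLHS]expRK ler_ln ?posrE ?expR_gt0 //; last by lra.
have h := expR_ge1Dx (- (2^-1 * w)).
have EE : expR (2^-1 * w) * expR (- (2^-1 * w)) = 1 by rewrite -expRD subrr expR0.
have E0 := expR_ge0 (2^-1 * w).
have := ler_wpM2l E0 h; rewrite EE => h2.
nra.
Qed.

Lemma clamp1_sqr (z mu : R) : `|mu| <= 1 ->
  (clamp1 z - mu) ^+ 2 <= 4 /\ (clamp1 z - mu) ^+ 2 <= (z - mu) ^+ 2.
Proof.
rewrite ler_norml => /andP[m1 m2]; rewrite /clamp1.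
have sq (a b : R) : 0 <= a -> a <= b -> a ^+ 2 <= b ^+ 2.
  by move=> a0 ab; rewrite lerXn2r // nnegrE // (le_trans a0).
have e4 : 4 = 2 ^+ 2 :> R by rewrite -natrX.
case: (lerP (-1) z) => h1; last first.
  have -> : Num.min 1 (-1) = -1 :> R by apply: min_r; lra.
  have -> : (-1 - mu) ^+ 2 = (1 + mu) ^+ 2 by ring.
  have -> : (z - mu) ^+ 2 = (mu - z) ^+ 2 by ring.
  by split; [rewrite e4; apply: sq | apply: sq]; lra.
case: (lerP 1 z) => h2.
  by split; [rewrite e4; apply: sq | apply: sq]; lra.
split => //; rewrite e4 -[(z - mu) ^+ 2]real_normK ?num_real //; apply: sq => //.
by rewrite ler_norml; apply/andP; split; lra.
Qed.

End RealInequalities.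

Lemma gram_ext (R : rcfType) n (lam : R) (x : nat -> 'rV[R]_n) (q q' : pred nat) t :
  (forall s, (s < t)%N -> q s = q' s) -> gram lam x q t = gram lam x q' t.
Proof. by move=> qq'; rewrite /gram; congr (_ + _); apply: eq_bigl => s; exact: qq'. Qed.

Lemma dotvE (R : realType) n (a b : 'rV[R]_n) : dotv a b = bilin 1%:M a b.
Proof. by rewrite /dotv /bilin mulmx1 mxE; apply: eq_bigr => i _; rewrite mxE. Qed.

(** * QuFUR as a function of the query pattern *)

Section Qufur.
Variables (R : realType) (d : nat) (c eta C : R) (x : nat -> 'rV[R]_d).
Hypotheses (c0 : 0 < c) (eta1 : 1 <= eta) (C0 : 0 < C).

Definition reg : R := C ^- 2.
(** Defined for an arbitrary pattern [q], so that it can be evaluated both along a run and on a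
    fixed 0/1 word. *)
Definition width (q : pred nat) t : R := qform (invmx (gram reg x q t)) (x t).
Definition capw (q : pred nat) t : R := Num.min 1 (width q t).
Definition qprob (q : pred nat) t : R := Num.min 1 (c * (eta ^+ 2 * capw q t)).

Lemma reg_gt0 : 0 < reg.
Proof. by rewrite invr_gt0 exprn_gt0. Qed.

Lemma width_ge0 q t : 0 <= width q t.
Proof. by apply: qform_inv_ge0; apply: gram_posdef reg_gt0. Qed.

Lemma capw_ge0 q t : 0 <= capw q t.
Proof. by rewrite le_min ler01 width_ge0. Qed.

Lemma capw_le1 q t : capw q t <= 1.
Proof. by rewrite ge_min lexx. Qed.

Lemma qprob_ge0 q t : 0 <= qprob q t.
Proof. by rewrite le_min ler01 mulr_ge0 ?(ltW c0) // mulr_ge0 ?sqr_ge0 ?capw_ge0. Qed.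

Lemma qprob_le1 q t : qprob q t <= 1.
Proof. by rewrite ge_min lexx. Qed.

Lemma capw_ext q q' t : (forall s, (s < t)%N -> q s = q' s) -> capw q t = capw q' t.
Proof. by move=> qq'; rewrite /capw /width (gram_ext _ _ qq'). Qed.

Lemma qprob_ext q q' t : (forall s, (s < t)%N -> q s = q' s) -> qprob q t = qprob q' t.
Proof. by move=> qq'; rewrite /qprob (capw_ext qq'). Qed.

Lemma qufur_step (y u : nat -> R) t (q : nat -> bool) :
  step (qufur c eta C) x y u t q =
  (clamp1 (bilin 1%:M ((\sum_(s < t | q s) y s *: x s) *m invmx (gram reg x q t)) (x t)),
   u t < qprob q t).
Proof.
rewrite /step /qufur leqnn.
have eM : (C ^- 2)%:M + \sum_(s < t | q s)
    (if (s <= t)%N then x s else 0)^T *m (if (s <= t)%N then x s else 0) = gram reg x q t.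
  by congr (_ + _); apply: eq_bigr => s _; rewrite ltnW.
have eb : \sum_(s < t | q s) (if q s then y s else 0) *: (if (s <= t)%N then x s else 0)
    = \sum_(s < t | q s) y s *: x s.
  by apply: eq_bigr => s ->; rewrite ltnW.
rewrite eM eb (max_r eta1) !dotvE; congr (_, _ < _).
by rewrite /qprob /capw /width /qform /bilin mulmx1.
Qed.

Variables (y u : nat -> R).
Let Q := query_at (qufur c eta C) x y u.

(** Labels enter the right side only through earlier query bits; by recursion the pattern is a
    function of the coins, so the design is independent of the noise. *)
Lemma qufur_query t : Q t = (u t < qprob Q t).
Proof.
rewrite {1}/Q /query_at qufur_step /=; congr (_ < _).
by apply: qprob_ext => s st; rewrite qhist_lt.
Qed.

Lemma qufur_pred t : pred_at (qufur c eta C) x y u t =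
  clamp1 (bilin 1%:M ((\sum_(s < t | Q s) y s *: x s) *m invmx (gram reg x Q t)) (x t)).
Proof.
rewrite /pred_at qufur_step /=; congr clamp1.
have e s : (s < t)%N -> qhist (qufur c eta C) x y u t s = Q s by move=> st; rewrite qhist_lt.
rewrite (gram_ext _ _ e); congr (bilin _ (_ *m _) _).
by apply: eq_bigl => s; rewrite e.
Qed.

End Qufur.

(** * Deterministic cost bound on the good event *)

Section CostBound.
Variables (R : realType) (d m : nat) (dd TT : 'I_m -> nat) (eta c C ell lg : R).
Let T := (\sum_(v < m) TT v)%N.
Hypotheses (m0 : (0 < m)%N) (dd0 : forall u, (0 < dd u)%N) (TT0 : forall u, (0 < TT u)%N).
Hypotheses (eta1 : 1 <= eta) (C0 : 0 < C).
Hypothesis c_ge : forall u, (dd u)%:R / (TT u)%:R <= c.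
Hypothesis c_le : forall u, c <= (TT u)%:R / ((dd u)%:R * eta ^+ 2).
Variables (th : 'rV[R]_d) (x : nat -> 'rV[R]_d) (dom : nat -> 'I_m).
Hypothesis domS : domain_structure dd TT x dom.
Hypothesis thC : norm2 th <= C.
Hypothesis x1 : forall t, (t < T)%N -> norm2 (x t) <= 1 /\ `|dotv th (x t)| <= 1.
Hypotheses (lg1 : 1 <= lg) (ell0 : 0 <= ell) (ell3 : ell <= 3 * lg).
Hypothesis lgC : ln (1 + T%:R / reg C) <= 2 * lg.
Variables (xi u : nat -> R).
Let y t := dotv th (x t) + xi t.
Let Q := query_at (qufur c eta C) x y u.
Let v := width C x Q.
Let w := capw C x Q.
Let p := qprob c eta C x Q.
Hypothesis explore : forall a,
  \sum_(t < T | dom t == a) p t * w t <= 2 * (\sum_(t < T | dom t == a) (Q t)%:R * w t) + 2 * ell.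
Hypothesis queries : \sum_(t < T) (Q t)%:R <= 2 * (\sum_(t < T) p t) + ell.
Hypothesis noise : forall t, (t < T)%N ->
  `|\sum_(s < t | Q s) bilin (invmx (gram (reg C) x Q t)) (x s) (x t) * xi s|
    <= eta * Num.sqrt (2 * ell * v t).

Let c0 : 0 < c.
Proof.
apply: lt_le_trans (c_ge (Ordinal m0)).
by rewrite divr_gt0 // ltr0n ?dd0 ?TT0.
Qed.

Let reg0 : 0 < reg C := reg_gt0 C0.
Let w0 t : 0 <= w t := capw_ge0 x C0 Q t.
Let v0 t : 0 <= v t := width_ge0 x C0 Q t.
Let D0 a : 0 < (dd a)%:R :> R. Proof. by rewrite ltr0n. Qed.
Let TT0' a : 0 < (TT a)%:R :> R. Proof. by rewrite ltr0n. Qed.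

Lemma card_dom a : #|[pred t : 'I_T | dom t == a]| = TT a.
Proof.
case: domS => h _; rewrite -[RHS]h; apply: eq_card => t; rewrite !inE.
by apply/idP/asboolP.
Qed.

Lemma qform1_norm2 n (z : 'rV[R]_n) : qform 1%:M z = norm2 z ^+ 2.
Proof. by rewrite /norm2 sqr_sqrtr dotvE ?qform1_ge0. Qed.

(** Below width 1 the squared error is split into noise and bias; above it the clamp gives 4. *)
Lemma regret_round t : (t < T)%N ->
  (pred_at (qufur c eta C) x y u t - dotv th (x t)) ^+ 2 <= (4 + 4 * eta ^+ 2 * ell) * w t.
Proof.
move=> tT; have [_ mu1] := x1 tT.
rewrite qufur_pred // -/Q.
set z := bilin _ _ _.
have [h4 hz] := clamp1_sqr z mu1.
have zE : z - dotv th (x t) = \sum_(s < t | Q s) bilin (invmx (gram (reg C) x Q t)) (x s) (x t) * xi s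
    - reg C * bilin 1%:M th (x t *m invmx (gram (reg C) x Q t)).
  rewrite -ridge_error // dotvE; congr (bilin _ (_ *m _) _ - _).
  by apply: eq_bigr => s _; rewrite /y dotvE.
have bias : (reg C * bilin 1%:M th (x t *m invmx (gram (reg C) x Q t))) ^+ 2 <= v t.
  apply: ridge_bias => //; rewrite qform1_norm2 /reg.
  rewrite ler_pdivrMl ?exprn_gt0 // mulr1 lerXn2r // nnegrE ?sqrtr_ge0 //; exact: ltW.
move: zE bias (noise tT); set n := \sum_(s < t | _) _; set bs := reg C * _ => zE bias nle.
have n2 : n ^+ 2 <= eta ^+ 2 * (2 * ell * v t).
  rewrite -real_normK ?num_real // -[leRHS]sqr_sqrtr; last first.
    by rewrite mulr_ge0 ?sqr_ge0 // mulr_ge0 ?mulr_ge0.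
  rewrite lerXn2r ?nnegrE ?sqrtr_ge0 //.
  by rewrite sqrtrM ?sqr_ge0 // sqrtr_sqr [`|eta|]ger0_norm // (le_trans ler01).
have e2 : 0 <= 4 * eta ^+ 2 * ell by rewrite mulr_ge0 // mulr_ge0 ?sqr_ge0.
have h3 : (clamp1 z - dotv th (x t)) ^+ 2 <= (4 + 4 * eta ^+ 2 * ell) * v t.
  apply: le_trans hz _; rewrite zE.
  have sq : (n - bs) ^+ 2 <= 2 * n ^+ 2 + 2 * bs ^+ 2.
    by rewrite -subr_ge0 (_ : _ - _ = (n + bs) ^+ 2) ?sqr_ge0 //; ring.
  apply: le_trans sq _; have := v0 t; move: n2 bias; move: (n ^+ 2) (bs ^+ 2) => A B; lra.
rewrite /w /capw -/(v t); case: (lerP 1 (v t)) => _ //; rewrite mulr1; lra.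
Qed.

(** The constant 4 is 2 from [min1_le_ln] times 2 from [lgC]. *)
Lemma explored a : \sum_(t < T | dom t == a) (Q t)%:R * w t <= 4 * (dd a)%:R * lg.
Proof.
case: domS => _ [B xB].
have P0 t : 0 < 1 + v t by have := v0 t; lra.
have le1 : \sum_(t < T | dom t == a) (Q t)%:R * w t
    <= 2 * ln (\prod_(t < T | Q t && (dom t == a)) (1 + v t)).
  have -> : ln (\prod_(t < T | Q t && (dom t == a)) (1 + v t))
      = \sum_(t < T | Q t && (dom t == a)) ln (1 + v t).
    have := @big_morph _ _ (@expR R) 1 *%R 0 +%R (@expRD R) (expR0 R).
    move=> /(_ _ (index_enum 'I_T) (fun t : 'I_T => Q t && (dom t == a)) (fun t => ln (1 + v t))) E.
    rewrite -[RHS]expRK E; congr ln; apply: eq_bigr => t _.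
    by rewrite lnK // posrE.
  rewrite mulr_sumr big_mkcond [leRHS]big_mkcond /=; apply: ler_sum => t _.
  case: (dom t == a); case: (Q t) => //=; rewrite ?mul0r // mul1r.
  exact: min1_le_ln.
apply: le_trans le1 _.
have prod_le : \prod_(t < T | Q t && (dom t == a)) (1 + v t) <= (1 + T%:R / reg C) ^+ dd a.
  apply: (elliptic_potential_subspace (B := B a) (q' := fun t => Q t && (dom t == a))) => //.
    by move=> s /andP[].
  move=> s sT /andP[_ /eqP <-]; split; last exact: xB.
  by rewrite qform1_norm2 expr_le1 ?sqrtr_ge0 //; case: (x1 sT).
have pr0 : 0 < \prod_(t < T | Q t && (dom t == a)) (1 + v t) by rewrite prodr_gt0.
have TC0 : 0 < 1 + T%:R / reg C by rewrite ltr_pwDl // divr_ge0 // ltW.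
have : ln (\prod_(t < T | Q t && (dom t == a)) (1 + v t)) <= ln ((1 + T%:R / reg C) ^+ dd a).
  by rewrite ler_ln ?posrE ?exprn_gt0.
rewrite lnXn // -(mulr_natl (ln _)).
have := ler_wpM2l (ltW (D0 a)) lgC; lra.
Qed.

Let W a := Num.sqrt c * Num.sqrt ((TT a)%:R * (dd a)%:R).

(** The lower end of the range of [c] gives [c T_u d_u >= d_u^2], so purely logarithmic costs are
    absorbed by the target. *)
Lemma W_ge1 a : 1 <= W a.
Proof.
rewrite /W -sqrtrM ?(ltW c0) // -[leLHS]sqrtr1 ler_wsqrtr //.
have h : (dd a)%:R <= c * (TT a)%:R by have := c_ge a; rewrite ler_pdivrMr.
have d1 : 1 <= (dd a)%:R :> R by rewrite ler1n.
by apply: (le_trans d1); apply: (le_trans h); rewrite mulrA ler_peMr // mulr_ge0 // ltW.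
Qed.

(* A round with [c eta^2 w <= 1] is queried with probability at least [c w], so the
   explored mass [p w] is of order [c w^2] and AM-GM with slope [gam] gives back [c w]. *)
Lemma width_sum a : c * \sum_(t < T | dom t == a) w t <= 15 * lg * W a.
Proof.
pose gam := Num.sqrt (c * (TT a)%:R / (dd a)%:R).
have ct0 : 0 < c * (TT a)%:R / (dd a)%:R by rewrite divr_gt0 // mulr_gt0.
have gam0 : 0 < gam by rewrite sqrtr_gt0.
have gam2 : gam ^+ 2 = c * (TT a)%:R / (dd a)%:R by rewrite sqr_sqrtr // ltW.
have e1 : 1 <= eta ^+ 2 by rewrite expr_ge1 // (le_trans ler01).
have e20 : 0 < eta ^+ 2 by lra.
have eta0 : 0 < eta by rewrite (lt_le_trans ltr01).
have t0 := TT0' a; have d0 := D0 a.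
(* This amounts to [c <= T_u / d_u], from the upper end of the range of [c]; it handles the rounds
   with [p t = 1]. *)
have cgam : c <= gam.
  rewrite -ler_sqr ?nnegrE ?(ltW c0) ?(ltW gam0) // gam2 expr2 -mulrA ler_pM2l //.
  apply: le_trans (c_le a) _; rewrite ler_wpM2l ?(ltW t0) // lef_pV2 ?posrE ?mulr_gt0 //.
  by rewrite ler_peMr ?(ltW d0).
have rnd t : c * w t <= gam * (p t * w t) + c / (4 * gam).
  have wt := w0 t; rewrite /p /qprob -/(w t).
  have g4 : 0 <= c / (4 * gam) by rewrite divr_ge0 ?mulr_ge0 ?(ltW c0) ?(ltW gam0).
  case: (lerP 1 (c * (eta ^+ 2 * w t))) => h.
    by have := ler_wpM2r wt cgam; lra.
  have cw : c * w t <= c * (eta ^+ 2 * w t).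
    by rewrite ler_wpM2l ?(ltW c0) // ler_peMl.
  have h1 : gam * (c * w t * w t) <= gam * (c * (eta ^+ 2 * w t) * w t).
    by rewrite ler_wpM2l ?(ltW gam0) // ler_wpM2r.
  apply: le_trans (lerD h1 (lexx _)).
  rewrite -subr_ge0.
  rewrite (_ : _ - _ = c / (4 * gam) * (2 * gam * w t - 1) ^+ 2); last first.
    by field; rewrite gt_eqF.
  by rewrite mulr_ge0 ?sqr_ge0.
(* 14 is twice the 4 of [explored] plus twice the 3 of [ell3]. *)
have S14 : \sum_(t < T | dom t == a) p t * w t <= 14 * (dd a)%:R * lg.
  have := explore a; have := explored a; have := ell3.
  have d1 : 1 <= (dd a)%:R :> R by rewrite ler1n.
  have l0 : 0 <= lg := le_trans ler01 lg1.
  have := ler_wpM2r l0 d1; lra.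
(* The slope balances both parts: [gam d_u] and [c T_u / gam] are equal to [W a]. *)
have gW : gam * (dd a)%:R = W a.
  rewrite /W -sqrtrM ?(ltW c0) // -{1}[(dd a)%:R]ger0_norm ?(ltW (D0 a)) // -sqrtr_sqr -sqrtrM ?(ltW ct0) //.
  by congr Num.sqrt; field; rewrite gt_eqF.
have cW : c / (4 * gam) * (TT a)%:R = W a / 4.
  rewrite -gW (_ : c / (4 * gam) * (TT a)%:R = (c * (TT a)%:R / (dd a)%:R) * (dd a)%:R / (4 * gam)).
    by rewrite -gam2; field; rewrite gt_eqF.
  by field; rewrite !gt_eqF.
rewrite mulr_sumr.
apply: le_trans (ler_sum _ (fun (t : 'I_T) _ => rnd t)) _.
rewrite big_split /= -mulr_sumr sumr_const card_dom -(mulr_natr (c / _)) cW.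
have := ler_wpM2l (ltW gam0) S14.
have -> : gam * (14 * (dd a)%:R * lg) = 14 * lg * W a by rewrite -gW; ring.
have W0 : 0 <= W a by rewrite (le_trans ler01) // W_ge1.
have := ler_wpM2r W0 lg1; lra.
Qed.

Lemma qufur_cost_le :
  total_cost (qufur c eta C) x y u c th T <=
  273 * eta ^+ 2 * lg ^+ 2 * Num.sqrt c * \sum_(a < m) Num.sqrt ((TT a)%:R * (dd a)%:R).
Proof.
pose S := \sum_a W a.
have S1 : 1 <= S.
  rewrite /S (bigD1 (Ordinal m0)) //=; apply: le_trans (W_ge1 (Ordinal m0)) _.
  by rewrite lerDl sumr_ge0 // => a _; rewrite (le_trans ler01) // W_ge1.
have -> : 273 * eta ^+ 2 * lg ^+ 2 * Num.sqrt c * \sum_(a < m) Num.sqrt ((TT a)%:R * (dd a)%:R)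
    = 273 * eta ^+ 2 * lg ^+ 2 * S by rewrite -[LHS]mulrA mulr_sumr.
have e1 : 1 <= eta ^+ 2 by rewrite expr_ge1 // (le_trans ler01).
have cw : c * \sum_(t < T) w t <= 15 * lg * S.
  rewrite (partition_big (fun t : 'I_T => dom t) xpredT) //= mulr_sumr /S mulr_sumr.
  by apply: ler_sum => a _; exact: width_sum.
have cw0 : 0 <= c * \sum_(t < T) w t by rewrite mulr_ge0 ?(ltW c0) ?sumr_ge0.
have reg_le : c * regret (qufur c eta C) x y u th T <= (4 + 4 * eta ^+ 2 * ell) * (15 * lg * S).
  have K0 : 0 <= 4 + 4 * eta ^+ 2 * ell by rewrite addr_ge0 // mulr_ge0 // mulr_ge0 ?sqr_ge0.
  apply: le_trans (ler_wpM2l K0 cw); rewrite mulrCA ler_wpM2l ?(ltW c0) // mulr_sumr.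
  by apply: ler_sum => t _; exact: regret_round.
have psum : \sum_(t < T) p t <= eta ^+ 2 * (c * \sum_(t < T) w t).
  rewrite mulrCA mulr_sumr mulr_sumr; apply: ler_sum => t _.
  by rewrite /p /qprob ge_min lexx orbT.
have q_le : nqueries (qufur c eta C) x y u T <= 2 * (eta ^+ 2 * (15 * lg * S)) + 3 * lg.
  have -> : nqueries (qufur c eta C) x y u T = \sum_(t < T) (Q t)%:R by [].
  apply: le_trans queries _; have e0 : 0 <= eta ^+ 2 by rewrite sqr_ge0.
  have := ler_wpM2l e0 cw; have := ell3; lra.
rewrite /total_cost.
have l0 : 0 <= lg := le_trans ler01 lg1.
have S0 : 0 <= S by lra.
have e0 : 0 <= eta ^+ 2 by lra.
(* 273 is [16 * 15] from the regret, [2 * 15] from the query probabilities and 3 from [ell]. *)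
have r1 : (4 + 4 * eta ^+ 2 * ell) * (15 * lg * S) <= 240 * (eta ^+ 2 * (lg ^+ 2 * S)).
  have k1 : 4 + 4 * eta ^+ 2 * ell <= 16 * eta ^+ 2 * lg.
    have := ler_wpM2l e0 ell3; have := ler_wpM2l e0 lg1; lra.
  have k2 : 0 <= 15 * lg * S by rewrite !mulr_ge0.
  apply: le_trans (ler_wpM2r k2 k1) _.
  rewrite le_eqVlt; apply/orP; left; apply/eqP; ring.
have lS0 : 0 <= lg * S by rewrite mulr_ge0.
have r2 : lg * S <= lg ^+ 2 * S.
  by rewrite expr2 -mulrA ler_peMl.
have r3 : eta ^+ 2 * (lg * S) <= eta ^+ 2 * (lg ^+ 2 * S) by rewrite ler_wpM2l.
have r4 : lg <= eta ^+ 2 * (lg ^+ 2 * S).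
  apply: (@le_trans _ _ (lg * S)); first by rewrite ler_peMr.
  apply: (le_trans r2); rewrite ler_peMl //; lra.
have -> : 273 * eta ^+ 2 * lg ^+ 2 * S = 273 * (eta ^+ 2 * (lg ^+ 2 * S)) by ring.
lra.
Qed.

End CostBound.

Lemma mem_words (X : finType) (b : seq X) n : (b \in words X n) = (size b == n).
Proof.
elim: n b => [|n IH] [|k b] //=.
  by apply/allpairsP => -[[k b] /= []].
rewrite eqSS -IH; apply/allpairsP/idP => [[[k' b'] /= [_ h [_ ->]]]//|bn].
by exists (k, b); split => //=; exact: mem_index_enum.
Qed.

Section Union.
Variables (R : realType) (dO : measure_display) (O : measurableType dO) (P : probability O R).

Lemma union_bound (I : Type) (s : seq I) (A : I -> set O) : (forall i, measurable (A i)) ->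
  (P (\big[setU/set0]_(i <- s) A i) <= \sum_(i <- s) P (A i))%E.
Proof.
move=> mA; elim: s => [|i s IH]; first by rewrite !big_nil measure0.
rewrite !big_cons; apply: le_trans (measureU2 _ _ _) _ => //.
  exact: bigsetU_measurable.
exact: leeD.
Qed.

Variables (U : O -> R) (q : R).
Hypotheses (uU : uniform01 P U) (q01 : 0 <= q <= 1).

Lemma uniform_lt : P (U @^-1` `]-oo, q[) = q%:E.
Proof.
have /andP[q0 q1] := q01; rewrite uU.2 //.
have -> : `]-oo, q[ `&` `[0%R, 1%R] = `[0%R, q[ :> set R.
  apply/seteqP; split => z /=; rewrite !in_itv /=.
    by case=> a /andP[b _]; rewrite b.
  by move=> /andP[-> zq]; split=> //=; rewrite (ltW (lt_le_trans zq q1)).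
rewrite lebesgue_measure_itv /= lte_fin; case: (ltrP 0 q) => h; first by rewrite sube0.
by congr EFin; apply/eqP; rewrite eq_le h q0.
Qed.

Lemma uniform_ge : P (U @^-1` `[q, +oo[) = (1 - q)%:E.
Proof.
have -> : U @^-1` `[q, +oo[ = ~` (U @^-1` `]-oo, q[).
  by apply/seteqP; split => w /=; rewrite !in_itv /= ?andbT leNgt => /negP.
rewrite probability_setC; last first.
  by rewrite -[V in measurable V]setTI; apply: uU.1.
by rewrite EFinB; congr (_ - _)%E; exact: uniform_lt.
Qed.

End Union.

(** * Probability of the good event *)

Section UpperBound.
Variables (R : realType) (d m : nat) (dd TT : 'I_m -> nat) (eta c C delta : R).
Let T := (\sum_(v < m) TT v)%N.
Hypotheses (m0 : (0 < m)%N) (dd0 : forall u, (0 < dd u)%N) (TT0 : forall u, (0 < TT u)%N).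
Hypotheses (eta1 : 1 <= eta) (C0 : 0 < C) (delta01 : 0 < delta < 1).
Hypothesis c_ge : forall u, (dd u)%:R / (TT u)%:R <= c.
Hypothesis c_le : forall u, c <= (TT u)%:R / ((dd u)%:R * eta ^+ 2).
Variables (th : 'rV[R]_d) (x : nat -> 'rV[R]_d) (dom : nat -> 'I_m).
Hypothesis domS : domain_structure dd TT x dom.
Hypothesis thC : norm2 th <= C.
Hypothesis x1 : forall t, (t < T)%N -> norm2 (x t) <= 1 /\ `|dotv th (x t)| <= 1.
Variables (dO : measure_display) (O : measurableType dO) (P : probability O R).
Variables (xi U : nat -> O -> R).
Hypothesis indepXU : indep_pair P T xi U.
Hypothesis subg : forall t, (t < T)%N -> subgaussian0 P (xi t) eta.
Hypothesis uU : forall t, (t < T)%N -> uniform01 P (U t).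

Let c0 : 0 < c.
Proof.
apply: lt_le_trans (c_ge (Ordinal m0)).
by rewrite divr_gt0 // ltr0n ?dd0 ?TT0.
Qed.
Let eta0 : 0 < eta := lt_le_trans ltr01 eta1.
Let d0 : 0 < delta. Proof. by case/andP: delta01. Qed.

Let mT : (m <= T)%N.
Proof.
rewrite -[X in (X <= _)%N]card_ord -sum1_card; apply: leq_sum => u _; exact: TT0.
Qed.
Let T1 : 1 <= T%:R :> R. Proof. by rewrite ler1n (leq_trans m0 mT). Qed.

(** Each failure costs [expR (- ell)]: one per domain, one for the number of queries, two noise
    tails per round, and [m + 1 + 2 T <= 4 T]. *)
Let ell : R := ln (4 * T%:R / delta).
Let lg : R := 1 + ln T%:R + ln (delta^-1) + `|ln C|.

Let expell : expR (- ell) = delta / (4 * T%:R).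
Proof.
have T0 : 0 < T%:R :> R by exact: lt_le_trans ltr01 T1.
rewrite expRN /ell lnK ?invf_div // posrE divr_gt0 // mulr_gt0 //.
Qed.

Let lnT0 : 0 <= ln T%:R :> R. Proof. exact: ln_ge0. Qed.
Let lnd0 : 0 <= ln (delta^-1).
Proof. by apply: ln_ge0; rewrite invf_ge1 //; case/andP: delta01 => _ /ltW. Qed.

Let lg1 : 1 <= lg.
Proof. by have := lnT0; have := lnd0; have := normr_ge0 (ln C); rewrite /lg; lra. Qed.

Let ln4 : ln 4 <= 3 :> R.
Proof.
have h : (4 : R) <= expR 3 by have := expR_ge1Dx (3 : R); lra.
by rewrite -[leRHS]expRK ler_ln ?posrE ?expR_gt0.
Qed.

Let ellE : ell = ln 4 + ln T%:R + ln (delta^-1).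
Proof.
have T0 : 0 < T%:R :> R by exact: lt_le_trans ltr01 T1.
by rewrite /ell !lnM ?posrE ?mulr_gt0 ?invr_gt0.
Qed.

Let ell0 : 0 <= ell.
Proof.
have h : 0 <= ln 4 :> R by apply: ln_ge0; rewrite ler1n.
by rewrite ellE !addr_ge0 ?lnT0 ?lnd0.
Qed.

Let ell3 : ell <= 3 * lg.
Proof.
rewrite ellE; have := ln4; have := lnT0; have := lnd0; have := normr_ge0 (ln C); rewrite /lg; lra.
Qed.

Let lgC : ln (1 + T%:R / reg C) <= 2 * lg.
Proof.
have T0 : 0 < T%:R :> R by exact: lt_le_trans ltr01 T1.
rewrite /reg invrK.
have C2 : 0 < C ^+ 2 by rewrite exprn_gt0.
have CE : C ^+ 2 = expR (2 * ln C) by rewrite expRM_natl lnK.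
set M := expR (2 * `|ln C|).
have M1 : 1 <= M by rewrite -expR0 ler_expR mulr_ge0.
have CM : C ^+ 2 <= M by rewrite CE ler_expR ler_wpM2l // ler_norm.
have h : 1 + T%:R * C ^+ 2 <= expR (1 + ln T%:R + 2 * `|ln C|).
  rewrite !expRD lnK // -/M.
  have e2 : 2 <= expR 1 :> R by have := expR_ge1Dx (1 : R); lra.
  have TM : 1 <= T%:R * M by rewrite (le_trans T1) // ler_peMr // ltW.
  have TC : T%:R * C ^+ 2 <= T%:R * M by rewrite ler_wpM2l // ltW.
  have TM0 : 0 <= T%:R * M by rewrite (le_trans ler01).
  have := ler_wpM2r TM0 e2; lra.
apply: (@le_trans _ _ (1 + ln T%:R + 2 * `|ln C|)).
  rewrite -[leRHS]expRK ler_ln ?posrE ?expR_gt0 // ltr_pwDl // mulr_ge0 // ltW //.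
have := lnT0; have := lnd0; rewrite /lg; lra.
Qed.

Let pr (b : seq bool) t := qprob c eta C x (nth false b) t.
Let cw (b : seq bool) t := capw C x (nth false b) t.

Let pr01 b t : 0 <= pr b t <= 1.
Proof. by rewrite qprob_ge0 // qprob_le1. Qed.

(** The conditional probability of the query bit [k] after the bits [h]; the product [wt b] along a
    word of length [T] is the probability of that pattern. *)
Let wgt (h : seq bool) (k : bool) : R := if k then pr h (size h) else 1 - pr h (size h).

Let wgt_ge0 h k : 0 <= wgt h k.
Proof. by have /andP[? ?] := pr01 h (size h); rewrite /wgt; case: k => //; rewrite subr_ge0. Qed.

Let take_pr b t : size b = T -> (t < T)%N -> pr (take t b) (size (take t b)) = pr b t.
Proof.
move=> sb tT; rewrite size_takel; last by rewrite sb ltnW.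
by apply: qprob_ext => s st; rewrite nth_take.
Qed.

Let take_cw b t : size b = T -> (t < T)%N -> cw (take t b) (size (take t b)) = cw b t.
Proof.
move=> sb tT; rewrite size_takel; last by rewrite sb ltnW.
by apply: capw_ext => s st; rewrite nth_take.
Qed.

Let wt (b : seq bool) : R := \prod_(t < T) wgt (take t b) (nth false b t).

Let wt_ge0 b : 0 <= wt b. Proof. by rewrite prodr_ge0. Qed.

(* Exponential Markov inequality for the query process: a predictable exponent [e] with
   [E exp e <= 1] at each step exceeds [ell] in total with probability at most [exp (- ell)]. *)
Lemma pattern_markov (e : seq bool -> bool -> R) (bad : pred (seq bool)) :
  (forall h, wgt h false * expR (e h false) + wgt h true * expR (e h true) <= 1) ->
  (forall b, size b = T -> bad b -> ell <= \sum_(t < T) e (take t b) (nth false b t)) ->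
  \sum_(b <- words bool T) (bad b)%:R * wt b <= expR (- ell).
Proof.
move=> e1 hbad.
pose V h k := wgt h k * expR (e h k).
have V0 h k : 0 <= V h k by rewrite mulr_ge0 ?expR_ge0.
have := sum_words_prod_le1 T [::] V0 e1.
move=> /(ler_wpM2l (expR_ge0 (- ell))); rewrite mulr1; apply: le_trans.
rewrite mulr_sumr big_seq [leRHS]big_seq; apply: ler_sum => b; rewrite mem_words => /eqP sb.
have -> : \prod_(t < T) V ([::] ++ take t b) (nth false b t)
    = wt b * expR (\sum_(t < T) e (take t b) (nth false b t)).
  by rewrite expR_sum -big_split.
rewrite mulrCA -expRD mulrC ler_wpM2l //.
case: (boolP (bad b)) => [/(hbad b sb) h|_] /=; last exact: expR_ge0.
by rewrite -[leLHS]expR0 ler_expR addrC subr_ge0.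
Qed.

Let bad1 a (b : seq bool) :=
  2 * (\sum_(t < T | dom t == a) (nth false b t)%:R * cw b t) + 2 * ell
    < \sum_(t < T | dom t == a) pr b t * cw b t.
Let bad2 (b : seq bool) :=
  2 * (\sum_(t < T) pr b t) + ell < \sum_(t < T) ((nth false b t)%:R : R).

(** The tilt [lam] is the capped width inside the domain and 0 outside; it is known from the prefix
    and at most 1. *)
Lemma bad1_le a : \sum_(b <- words bool T) (bad1 a b)%:R * wt b <= expR (- ell).
Proof.
pose lam h : R := if dom (size h) == a then cw h (size h) else 0.
apply: (@pattern_markov (fun h k => lam h * (pr h (size h) / 2 - k%:R))).
  move=> h; rewrite subr0; apply: bernoulli_mgf_lower => //.
  by rewrite /lam; case: ifP => _; rewrite ?lexx ?ler01 // capw_ge0 // capw_le1.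
move=> b sb; rewrite /bad1 => h.
have -> : \sum_(t < T) lam (take t b) * (pr (take t b) (size (take t b)) / 2 - (nth false b t)%:R)
   = (\sum_(t < T | dom t == a) pr b t * cw b t) / 2 - \sum_(t < T | dom t == a) (nth false b t)%:R * cw b t.
  rewrite mulr_suml -sumrB [RHS]big_mkcond /=; apply: eq_bigr => t _.
  rewrite take_pr // /lam take_cw // size_takel; last by rewrite sb ltnW.
  by case: ifP => _; rewrite ?mul0r //; ring.
lra.
Qed.

Lemma bad2_le : \sum_(b <- words bool T) (bad2 b)%:R * wt b <= expR (- ell).
Proof.
apply: (@pattern_markov (fun h k => k%:R - 2 * pr h (size h))).
  by move=> h; rewrite sub0r; exact: bernoulli_mgf_upper.
move=> b sb; rewrite /bad2 => h.
rewrite sumrB -mulr_sumr [V in _ * V](eq_bigr (fun t : 'I_T => pr b t)); last by move=> t _; rewrite take_pr.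
lra.
Qed.

Lemma wt_sum : \sum_(b <- words bool T) wt b <= 1.
Proof.
apply: (sum_words_prod_le1 (W := wgt) T [::]) => // h.
by rewrite /wgt subrK.
Qed.

(** The coin values with which round [t] continues the pattern [b], half-open because a query means
    a strict inequality. *)
Let slab (b : seq bool) (t : nat) : set R :=
  if nth false b t then `]-oo, pr b t[ else `[pr b t, +oo[.

Let pattern b := [set w | forall t : 'I_T, slab b t (U t w)].

Let mslab b t : measurable (slab b t).
Proof. by rewrite /slab; case: ifP => _; exact: measurable_itv. Qed.

Let prob_slab b (t : 'I_T) : size b = T ->
  P (U t @^-1` slab b t) = (wgt (take t b) (nth false b t))%:E.
Proof.
move=> sb; rewrite /wgt take_pr // /slab; case: ifP => _.
  by rewrite uniform_lt //; exact: uU.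
by rewrite uniform_ge //; exact: uU.
Qed.

(** Noise weights of the prediction at [t], extended by 0 to all rounds to fit [noise_tail]. *)
Let coef (b : seq bool) (t s : nat) : R :=
  if (s < t)%N && nth false b s
  then bilin (invmx (gram (reg C) x (nth false b) t)) (x s) (x t) else 0.

Let coefE b t (z : nat -> R) : (t <= T)%N ->
  \sum_(s < t | nth false b s) bilin (invmx (gram (reg C) x (nth false b) t)) (x s) (x t) * z s
  = \sum_(s < T) coef b t s * z s.
Proof.
move=> tT; rewrite (big_ord_widen_cond T (nth false b)
  (fun s => bilin (invmx (gram (reg C) x (nth false b) t)) (x s) (x t) * z s)) //.
rewrite big_mkcond; apply: eq_bigr => s _; rewrite /coef andbC.
by case: ifP => _; rewrite ?mul0r.
Qed.

Let noisy (g : R) b (t : nat) :=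
  [set w | (eta * Num.sqrt (2 * ell * width C x (nth false b) t) < \sum_(s < T) (g * coef b t s) * xi s w)%R].

(** The sign [g] gives the two tails. *)
Lemma noisy_le g b (t : 'I_T) : g ^+ 2 = 1 -> size b = T ->
  measurable (pattern b `&` noisy g b t) /\
  (P (pattern b `&` noisy g b t) <= (wt b * expR (- ell))%:E)%E.
Proof.
move=> g1 sb; split.
  apply: measurableI.
    exact: (measurable_event indepXU (B := fun s : 'I_T => slab b s) (fun s => mslab b s)).
  have mN : measurable_fun setT (fun w => \sum_(s < T) (g * coef b t s) * xi s w).
    apply: measurable_sum => s; apply: measurable_funM => //.
    by case: indepXU => h _; exact: (h (inl s)).
  by rewrite -[V in measurable V]setTI; apply: (@measurable_fun_ltr _ _ _ setT (cst _)).
apply: (noise_tail eta0 indepXU subg (B := fun s : 'I_T => slab b s)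
  (pB := fun s : 'I_T => wgt (take s b) (nth false b s)) _ _ _ ell0).
- by move=> s; exact: mslab.
- by move=> s; exact: prob_slab.
- have := ridge_noise_weight x (nth false b) t (x t) (reg_gt0 C0).
  apply: le_trans.
  under eq_bigr => s _ do rewrite exprMn g1 mul1r expr2.
  rewrite -(@coefE b t (coef b t)) 1?ltnW //.
  rewrite le_eqVlt; apply/orP; left; apply/eqP; apply: eq_bigr => s bs.
  by rewrite /coef ltn_ord bs expr2.
Qed.

(** A pattern that violates the query bounds is discarded entirely; from the others only the noise
    deviations are removed. *)
Let badset b : set O :=
  if [exists a, bad1 a b] || bad2 b then pattern b
  else \big[setU/set0]_(t < T) ((pattern b `&` noisy 1 b t) `|` (pattern b `&` noisy (-1) b t)).

Lemma badset_le b : size b = T -> measurable (badset b) /\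
  (P (badset b) <= (\sum_a (bad1 a b)%:R * wt b + (bad2 b)%:R * wt b
                    + 2 * T%:R * expR (- ell) * wt b)%:E)%E.
Proof.
move=> sb; rewrite /badset.
have mp : measurable (pattern b).
  exact: (measurable_event indepXU (B := fun s : 'I_T => slab b s) (fun s => mslab b s)).
have n1 t := noisy_le t (expr1n R 2) sb.
have n2 t := noisy_le t (sqrr_sign R 1) sb.
have b1 : 0 <= \sum_a (bad1 a b)%:R * wt b by rewrite sumr_ge0 // => a _; rewrite mulr_ge0.
have b2 : 0 <= (bad2 b)%:R * wt b by rewrite mulr_ge0.
have b3 : 0 <= 2 * T%:R * expR (- ell) * wt b by rewrite !mulr_ge0 ?expR_ge0.
case: ifP => [|_].
  move=> hb; split => //.
  have Pp : P (pattern b) = (wt b)%:E.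
    pose Bf (i : 'I_T + 'I_T) : set R := match i with inl _ => setT | inr t => slab b t end.
    have mBf i : measurable (Bf i) by case: i => t; [exact: measurableT | exact: (mslab b t)].
    have -> : pattern b = [set w | forall i : 'I_T + 'I_T, i \in [set: 'I_T + 'I_T]%SET ->
        Bf i ((match i with inl t => xi t | inr t => U t end) w)].
      apply/seteqP; split => w /= h.
        by case=> t _ //=; exact: h.
      by move=> t; have := h (inr t); apply; rewrite inE.
    apply: (etrans (indepXU.2 [set: 'I_T + 'I_T]%SET Bf mBf)).
    rewrite (eq_bigl xpredT) => [|i]; last by rewrite inE.
    rewrite big_sumType /= big1 ?mul1e; last first.
      by move=> t _; rewrite preimage_setT probability_setT.
    rewrite (eq_bigr (fun t : 'I_T => (wgt (take t b) (nth false b t))%:E)) => [|t _]; last exact: prob_slab.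
    by rewrite (big_morph EFin (fun x y => EFinM x y) (erefl 1%E)).
  rewrite Pp lee_fin.
  have : wt b <= \sum_a (bad1 a b)%:R * wt b + (bad2 b)%:R * wt b.
    case/orP: hb => [/existsP[a ha]|h2]; last by rewrite h2 mul1r; lra.
    rewrite (bigD1 a) //= ha mul1r -addrA lerDl addr_ge0 // sumr_ge0 // => a' _.
    by rewrite mulr_ge0.
  lra.
split.
  by apply: bigsetU_measurable => t _; apply: measurableU; [case: (n1 t) | case: (n2 t)].
apply: le_trans (union_bound _ _ _) _.
  by move=> t; apply: measurableU; [case: (n1 t) | case: (n2 t)].
apply: (@le_trans _ _ (\sum_(t < T) (2 * (wt b * expR (- ell)))%:E)%E).
  apply: lee_sum => t _.
  apply: le_trans (measureU2 _ (n1 t).1 (n2 t).1) _.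
  by rewrite mulr_natl mulr2n EFinD; apply: leeD; [case: (n1 t) | case: (n2 t)].
rewrite sumEFin lee_fin sumr_const card_ord -(mulr_natl (2 * _)).
move: (expR _) b3 => E b3; lra.
Qed.

Lemma upper_bound : exists A : set O, measurable A /\ (P A >= (1 - delta)%:E)%E /\
  forall w, A w ->
    total_cost (qufur c eta C) x (fun t => dotv th (x t) + xi t w) (fun t => U t w) c th T
    <= 273 * eta ^+ 2 * lg ^+ 2 * Num.sqrt c * \sum_(a < m) Num.sqrt ((TT a)%:R * (dd a)%:R).
Proof.
pose bs b := if size b == T then badset b else set0.
have mbs b : measurable (bs b).
  by rewrite /bs; case: eqP => // sb; case: (badset_le sb).
pose Bad := \big[setU/set0]_(b <- words bool T) bs b.
have mBad : measurable Bad by exact: bigsetU_measurable.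
exists (~` Bad); split; first exact: measurableC.
split.
  rewrite probability_setC // EFinB leeD2l // leeN2.
  apply: le_trans (union_bound _ _ _) _ => //.
  apply: (@le_trans _ _ (\sum_(b <- words bool T) (\sum_a (bad1 a b)%:R * wt b + (bad2 b)%:R * wt b
                    + 2 * T%:R * expR (- ell) * wt b)%:E)%E).
    rewrite big_seq [leRHS]big_seq; apply: lee_sum => b; rewrite mem_words => /eqP sb.
    by rewrite /bs sb eqxx; case: (badset_le sb).
  rewrite sumEFin lee_fin !big_split /= exchange_big /= -mulr_sumr.
  have h1 : \sum_(a < m) \sum_(b <- words bool T) (bad1 a b)%:R * wt b <= m%:R * expR (- ell).
    rewrite -[m%:R](_ : \sum_(a < m) 1 = _); last by rewrite sumr_const card_ord.
    by rewrite mulr_suml; apply: ler_sum => a _; rewrite mul1r; exact: bad1_le.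
  have E0 := expR_ge0 (- ell).
  (* The weights of all patterns sum to at most 1, so their number does not appear. *)
  have h3 : 2 * T%:R * expR (- ell) * (\sum_(b <- words bool T) wt b) <= 2 * T%:R * expR (- ell).
    rewrite ler_piMr ?wt_sum // !mulr_ge0 //.
  have h2 := bad2_le.
  have mTR : m%:R <= T%:R :> R by rewrite ler_nat.
  have h4 : m%:R * expR (- ell) <= T%:R * expR (- ell) by rewrite ler_wpM2r.
  have h5 : expR (- ell) <= T%:R * expR (- ell) by rewrite ler_peMl.
  have h6 : 4 * (T%:R * expR (- ell)) = delta.
    rewrite expell; field; rewrite gt_eqF //; exact: lt_le_trans ltr01 T1.
  apply: le_trans (lerD (lerD h1 h2) h3) _.
  by rewrite -(mulrA 2); lra.
move=> w nB.
set y := fun t => dotv th (x t) + xi t w; set u := fun t => U t w.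
pose Q := query_at (qufur c eta C) x y u.
pose b := mkseq Q T.
have sb : size b = T by rewrite size_mkseq.
have bQ t : (t < T)%N -> nth false b t = Q t by move=> tT; rewrite nth_mkseq.
have bQ' t : (t <= T)%N -> forall s, (s < t)%N -> nth false b s = Q s.
  by move=> tT s st; apply: bQ; apply: leq_trans tT.
have prQ t : (t < T)%N -> pr b t = qprob c eta C x Q t.
  by move=> tT; apply: qprob_ext; apply: bQ'; rewrite ltnW.
have cwQ t : (t < T)%N -> cw b t = capw C x Q t.
  by move=> tT; apply: capw_ext; apply: bQ'; rewrite ltnW.
(* The word [b] is the pattern realised at [w], so each coin lies in the slab of its own query
   bit. *)
have pw : pattern b w.
  move=> t; rewrite /slab bQ // prQ //.
  have := @qufur_query R d c eta C x eta1 y u t; rewrite -/Q => ->.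
  by case: ifPn => h /=; rewrite in_itv /= ?andbT // leNgt.
have nbad : ~ badset b w.
  move=> hb; apply: nB; rewrite /Bad -bigcup_seq; exists b => /=.
    by rewrite mem_words sb.
  by rewrite /bs sb eqxx.
have nb : ([exists a, bad1 a b] || bad2 b) = false.
  by apply/negP => h; apply: nbad; rewrite /badset h.
have nn g (t : 'I_T) : (g = 1 \/ g = -1) -> ~ noisy g b t w.
  move=> hg hn; apply: nbad; rewrite /badset nb -bigcup_seq; exists t => /=.
    exact: mem_index_enum.
  by case: hg hn => -> hn; [left | right].
have /norP[/existsPn nb1 nb2] := negbT nb.
apply: (qufur_cost_le (ell := ell) m0 dd0 TT0 eta1 C0 c_ge c_le domS thC x1) => //.
- move=> a; have := nb1 a; rewrite /bad1 -leNgt.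
  rewrite (eq_bigr (fun t : 'I_T => qprob c eta C x Q t * capw C x Q t)); last first.
    by move=> t _; rewrite prQ // cwQ.
  rewrite [\sum_(t < T | _) _%:R * _](eq_bigr (fun t : 'I_T => (Q t)%:R * capw C x Q t)) //.
  by move=> t _; rewrite bQ // cwQ.
- move: nb2; rewrite /bad2 -leNgt.
  have -> : \sum_(t < T) ((nth false b t)%:R : R) = \sum_(t < T) (Q t)%:R.
    by apply: eq_bigr => t _; rewrite bQ.
  have -> : \sum_(t < T) pr b t = \sum_(t < T) qprob c eta C x Q t.
    by apply: eq_bigr => t _; rewrite prQ.
  by [].
- move=> t tT.
  have gE : gram (reg C) x (nth false b) t = gram (reg C) x Q t.
    by apply: gram_ext; apply: bQ'; rewrite ltnW.
  have wE : width C x (nth false b) t = width C x Q t by rewrite /width gE.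
  have := nn 1 (Ordinal tT) (or_introl erefl); have := nn (-1) (Ordinal tT) (or_intror erefl).
  rewrite /noisy /= wE => /negP; rewrite -leNgt => h1 /negP; rewrite -leNgt => h2.
  rewrite -gE (eq_bigl (fun s : 'I_t => nth false b s)); last first.
    by move=> s; rewrite (bQ' t) // ltnW.
  rewrite (coefE b (xi^~ w)) 1?ltnW // ler_norml.
  apply/andP; split.
    rewrite lerNl; apply: le_trans h1; rewrite -sumrN le_eqVlt; apply/orP; left; apply/eqP.
    by apply: eq_bigr => s _; rewrite mulN1r mulNr.
  apply: le_trans h2; rewrite le_eqVlt; apply/orP; left; apply/eqP.
  by apply: eq_bigr => s _; rewrite mul1r.
Qed.

End UpperBound.

Theorem mainTheorem15 (R : realType) (etamax : R) (etamax_ge1 : 1 <= etamax) :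
  (* (1) upper bound for QuFUR(c): W = O~(sqrt c * sum_u sqrt(T_u d_u)) w.p. >= 1 - delta *)
  (exists (K : R) (a : nat),
    forall (d m : nat) (dd TT : 'I_m -> nat) (eta c C delta : R),
    (0 < m)%N ->
    (forall u, 0 < dd u)%N -> (forall u, 0 < TT u)%N ->
    (forall u, dd u <= TT u)%N ->
    (\sum_(u < m) dd u <= d)%N ->
    1 <= eta -> eta <= etamax ->
    (forall u, eta <= (TT u)%:R / (dd u)%:R) ->
    (forall u, (dd u)%:R / (TT u)%:R <= c) ->
    (forall u, c <= (TT u)%:R / ((dd u)%:R * eta ^+ 2)) ->
    0 < C -> 0 < delta < 1 ->
    forall (th : 'rV[R]_d) (x : nat -> 'rV[R]_d) (dom : nat -> 'I_m),
    domain_structure dd TT x dom ->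
    norm2 th <= C ->
    (forall t, (t < \sum_(u < m) TT u)%N -> norm2 (x t) <= 1 /\ `|dotv th (x t)| <= 1) ->
    forall (dO : measure_display) (O : measurableType dO) (P : probability O R)
           (xi U : nat -> O -> R),
    indep_pair P (\sum_(u < m) TT u) xi U ->
    (forall t, (t < \sum_(u < m) TT u)%N -> subgaussian0 P (xi t) eta) ->
    (forall t, (t < \sum_(u < m) TT u)%N -> uniform01 P (U t)) ->
    exists A : set O, measurable A /\ (P A >= (1 - delta)%:E)%E /\
      forall w, A w ->
        total_cost (qufur c eta C) x (fun t => dotv th (x t) + xi t w) (fun t => U t w)
          c th (\sum_(u < m) TT u)
        <= K * (1 + ln (\sum_(u < m) TT u)%:R + ln (delta^-1) + `|ln C|) ^+ a
             * Num.sqrt c * \sum_(u < m) Num.sqrt ((TT u)%:R * (dd u)%:R))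
  /\
  (* (2) lower bound: every algorithm has expected cost Omega(sqrt c * sum_u sqrt(T_u d_u))
         on some environment *)
  (exists k : R, 0 < k /\
    forall (d m : nat) (dd TT : 'I_m -> nat) (eta c : R),
    (0 < m)%N ->
    (forall u, 0 < dd u)%N -> (forall u, 0 < TT u)%N ->
    (forall u, dd u <= TT u)%N ->
    (\sum_(u < m) dd u <= d)%N ->
    1 <= eta -> eta <= etamax ->
    (forall u, eta <= (TT u)%:R / (dd u)%:R) ->
    (forall u, (dd u)%:R / (TT u)%:R <= c) ->
    (forall u, c <= (TT u)%:R / ((dd u)%:R * eta ^+ 2)) ->
    forall (dO : measure_display) (O : measurableType dO) (P : probability O R)
           (U Z : nat -> O -> R),
    indep_pair P (\sum_(u < m) TT u) U Z ->
    (forall t, (t < \sum_(u < m) TT u)%N -> uniform01 P (U t) /\ uniform01 P (Z t)) ->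
    forall alg : policy R d,
    (forall (th : 'rV[R]_d) (x : nat -> 'rV[R]_d) (xi : nat -> O -> R),
       (forall t, measurable_fun setT (xi t)) ->
       measurable_fun setT (fun w =>
         total_cost alg x (fun t => dotv th (x t) + xi t w) (fun t => U t w)
           c th (\sum_(u < m) TT u))) ->
    exists (th : 'rV[R]_d) (x : nat -> 'rV[R]_d) (dom : nat -> 'I_m) (g : nat -> R -> R),
      domain_structure dd TT x dom /\
      norm2 th <= Num.sqrt d%:R /\
      (forall t, (t < \sum_(u < m) TT u)%N -> norm2 (x t) <= 1 /\ `|dotv th (x t)| <= 1) /\
      (forall t, (t < \sum_(u < m) TT u)%N ->
         measurable_fun setT (g t) /\ subgaussian0 P (g t \o Z t) eta) /\
      ('E_P[fun w =>
          (total_cost alg x (fun t => dotv th (x t) + g t (Z t w)) (fun t => U t w)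
            c th (\sum_(u < m) TT u))%R]
        >= (k * Num.sqrt c * \sum_(u < m) Num.sqrt ((TT u)%:R * (dd u)%:R))%:E)%E).
Proof.
split.
- exists (273 * etamax ^+ 2), 2%N.
  move=> d m dd TT eta c C delta m0 dd0 TT0 _ _ eta1 etam _ c_ge c_le C0 delta01.
  move=> th x dom domS thC x1 dO O P xi U indepXU subg uU.
  have [A [mA [PA hA]]] := upper_bound m0 dd0 TT0 eta1 C0 delta01 c_ge c_le domS thC x1 indepXU subg uU.
  exists A; split => //; split => // w /hA h; apply: le_trans h _.
  rewrite !ler_wpM2r ?sumr_ge0 ?sqrtr_ge0 ?exprn_even_ge0 //.
  by rewrite ler_wpM2l // lerXn2r // nnegrE (le_trans ler01) // (le_trans eta1).
- exists 2048^-1; split; first by rewrite invr_gt0 ltr0n.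
  move=> d m dd TT eta c m0 dd0 TT0 ddTT ddd eta1 _ _ c_ge _ dO O P U Z _ uUZ alg malg.
  exact: (lower_bound m0 dd0 TT0 ddTT ddd eta1 c_ge (fun t tT => (uUZ t tT).2) malg).
Qed.
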